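(* For every natural number $m\geq 2$ and every natural number $L$ such that there exist polynomials $P,Q$ of degree at most $[m/2]-1$ for which the planar system $\dot x=P(x,y)$, $\dot y=Q(x,y)$ has at least $L$ hyperbolic limit cycles, one has $N_h(m)\geq L$. In the paper's notation: $N_h(m)\geq \underline{H}_h\left(\left[\frac{m}{2}\right]-1\right)$.
   Context: $[\cdot]$ denotes the integer part. For a polynomial system $\dot x=P(x,y,z)$, $\dot y=Q(x,y,z)$, $\dot z=R(x,y,z)$, let $\tau_h(P,Q,R)$ be its number of normally hyperbolic invariant tori, and define $N_h(m):=\sup\{\tau_h(P,Q,R):\deg P,\deg Q,\deg R\le m\}$ (possibly $+\infty$). For planar polynomial systems $\dot x=P(x,y)$, $\dot y=Q(x,y)$, let $\pi_h(P,Q)$ be the number of hyperbolic limit cycles and $H_h(k):=\sup\{\pi_h(P,Q):\deg P,\deg Q\le k\}$; $\underline{H}_h(k)$ denotes any finite lower bound for $H_h(k)$. *)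

(* Defs.v *)
From HB Require Import structures.
From mathcomp Require Import all_boot all_order all_algebra.
From mathcomp Require Import all_classical all_reals all_analysis.
From mathcomp Require Import Rstruct Rstruct_topology.
Set Implicit Arguments. Unset Strict Implicit. Unset Printing Implicit Defensive.
Import Order.TTheory GRing.Theory Num.Theory.
Import numFieldNormedType.Exports.
Local Open Scope classical_set_scope.
Local Open Scope ring_scope.

Section Defs.
Variable RR : realType.

(** Polynomials in n real variables of total degree <= k, given by their
    coefficients on the monomials x_0^(a 0) ... x_(n-1)^(a (n-1)). *)
Definition monom (n k : nat) := {ffun 'I_n -> 'I_k.+1}.
Definition mdeg (n k : nat) (a : monom n k) : nat := (\sum_(i < n) (a i : nat))%N.

Definition peval (n k : nat) (c : monom n k -> RR) (x : 'rV[RR]_n) : RR :=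
  \sum_(a : monom n k | (mdeg a <= k)%N) c a * \prod_(i < n) x ord0 i ^+ (a i : nat).

Definition pderiv (n k : nat) (c : monom n k -> RR) (j : 'I_n) (x : 'rV[RR]_n) : RR :=
  \sum_(a : monom n k | (mdeg a <= k)%N)
     c a * (a j : nat)%:R * \prod_(i < n) x ord0 i ^+ ((a i : nat) - (i == j))%N.

Definition vf (n k : nat) (c : 'I_n -> monom n k -> RR) (x : 'rV[RR]_n) : 'rV[RR]_n :=
  \row_i peval (c i) x.

Definition Jac (n k : nat) (c : 'I_n -> monom n k -> RR) (x : 'rV[RR]_n) : 'M[RR]_n :=
  \matrix_(i, j) pderiv (c i) j x.

Definition is_sol (n k : nat) (c : 'I_n -> monom n k -> RR) (x : RR -> 'rV[RR]_n) :=
  forall t : RR, derivable x t 1 /\ derive1 x t = vf c (x t).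

(** Y is the fundamental matrix of the variational equation along x:
    Y' = DF(x(t)) Y, Y(0) = I  (Y t is the derivative of the flow map
    at x 0, acting on column vectors). *)
Definition is_fundamental (n k : nat) (c : 'I_n -> monom n k -> RR)
    (x : RR -> 'rV[RR]_n) (Y : RR -> 'M[RR]_n) :=
  Y 0 = 1%:M /\ forall t : RR, derivable Y t 1 /\ derive1 Y t = Jac c (x t) *m Y t.

Definition periodic_orbit (n k : nat) (c : 'I_n -> monom n k -> RR) (C : set 'rV[RR]_n) :=
  exists (x : RR -> 'rV[RR]_n) (T : RR),
    [/\ is_sol c x, 0 < T, (forall t, x (t + T) = x t),
        (exists t, x t != x 0) & C = range x].

Definition limit_cycle (n k : nat) (c : 'I_n -> monom n k -> RR) (C : set 'rV[RR]_n) :=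
  periodic_orbit c C /\
  exists e : RR, 0 < e /\
    forall C', periodic_orbit c C' ->
      (forall y, C' y -> exists z, C z /\ `|y - z| < e) -> C' = C.

(** Planar hyperbolic periodic orbit: with x a parametrization of minimal
    period T and monodromy matrix Y T, the Floquet multipliers are 1 and mu
    (char. polynomial (X-1)(X-mu)) and the nontrivial one satisfies |mu| <> 1. *)
Definition hyperbolic_cycle2 (k : nat) (c : 'I_2 -> monom 2 k -> RR) (C : set 'rV[RR]_2) :=
  exists (x : RR -> 'rV[RR]_2) (T : RR) (Y : RR -> 'M[RR]_2),
    [/\ is_sol c x, 0 < T, (forall t, x (t + T) = x t),
        (forall s, 0 < s -> s < T -> x s != x 0)
      & C = range x] /\ is_fundamental c x Y /\
        exists mu : RR, `|mu| != 1 /\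
          char_poly (Y T) = ('X - 1%:P) * ('X - mu%:P).

Definition hyperbolic_limit_cycle2 (k : nat) (c : 'I_2 -> monom 2 k -> RR)
    (C : set 'rV[RR]_2) :=
  limit_cycle c C /\ hyperbolic_cycle2 c C.

Definition du (h : RR -> RR -> 'rV[RR]_3) (u v : RR) := derive1 (fun s => h s v) u.
Definition dv (h : RR -> RR -> 'rV[RR]_3) (u v : RR) := derive1 (fun s => h u s) v.

Definition torus_embedding (h : RR -> RR -> 'rV[RR]_3) :=
  [/\ (forall u v, h (u + 1) v = h u v /\ h u (v + 1) = h u v),
      (forall u v u' v', h u v = h u' v' -> (u - u') \is a Num.int /\ (v - v') \is a Num.int),
      (forall u v, derivable (fun s => h s v) u 1 /\ derivable (fun s => h u s) v 1),
      continuous (fun p : RR * RR => du h p.1 p.2)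
    & continuous (fun p : RR * RR => dv h p.1 p.2)] /\
  (forall u v, row_free (col_mx (du h u v) (dv h u v))).

(** Tangent space of the torus at h u v (row space of this matrix). *)
Definition tangent (h : RR -> RR -> 'rV[RR]_3) (u v : RR) : 'M[RR]_(1 + 1, 3) :=
  col_mx (du h u v) (dv h u v).

(** M is a normally hyperbolic invariant torus of x' = F(x) on R^3:
    M is a C^1-embedded invariant 2-torus, and along M the linearized flow
    (fundamental matrices Y p t of the variational equation along the
    solution sol p through p, acting on vectors w as w^T |-> Y w) leaves
    invariant a splitting T_pM (+) Es p (+) Eu p = R^3 with
    exponential contraction on Es, expansion on Eu, dominating the
    tangential rates. *)
Definition nh_invariant_torus (m : nat) (c : 'I_3 -> monom 3 m -> RR) (M : set 'rV[RR]_3) :=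
  exists h : RR -> RR -> 'rV[RR]_3,
  [/\ torus_embedding h,
      M = [set y | exists u v, h u v = y]
    & exists (sol : 'rV[RR]_3 -> RR -> 'rV[RR]_3) (Y : 'rV[RR]_3 -> RR -> 'M[RR]_3)
             (Es Eu : 'rV[RR]_3 -> 'M[RR]_3) (K a b : RR),
      [/\ (forall p, M p ->
             [/\ is_sol c (sol p), sol p 0 = p, (forall t, M (sol p t))
               & is_fundamental c (sol p) (Y p)]),
          (forall u v,
             row_full (col_mx (col_mx (tangent h u v) (Es (h u v))) (Eu (h u v))) /\
             (\rank (tangent h u v) + \rank (Es (h u v)) + \rank (Eu (h u v)) = 3)%N),
          (forall p t, M p ->
             (Es p *m (Y p t)^T <= Es (sol p t))%MS /\
             (Eu p *m (Y p t)^T <= Eu (sol p t))%MS),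
          0 < K /\ b < a /\ 0 < a
        & forall p (t : RR) (w : 'rV[RR]_3), M p -> 0 <= t ->
          [/\ ((w <= Es p)%MS -> `|w *m (Y p t)^T| <= K * expR (- (a * t)) * `|w|),
              ((w <= Eu p)%MS -> `|w *m (Y p (- t))^T| <= K * expR (- (a * t)) * `|w|)
            & (forall u v, h u v = p -> (w <= tangent h u v)%MS ->
                `|w *m (Y p t)^T| <= K * expR (b * t) * `|w| /\
                `|w *m (Y p (- t))^T| <= K * expR (b * t) * `|w|)]]].

End Defs.

(* Main.v *)
Require Import Defs.
From HB Require Import structures.
From mathcomp Require Import all_boot all_order all_algebra.
From mathcomp Require Import all_classical all_reals all_analysis.
From mathcomp Require Import Rstruct Rstruct_topology.
From mathcomp Require Import ring lra zify.
Set Implicit Arguments. Unset Strict Implicit. Unset Printing Implicit Defensive.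
Import Order.TTheory GRing.Theory Num.Theory.
Import numFieldNormedType.Exports.
Local Open Scope classical_set_scope.
Local Open Scope ring_scope.

(** Translate the planar system so that all the cycles lie in [r > 0], multiply
    the field by [r], and rotate the half-plane [(r, z)] around the [z]-axis with
    [r = x^2 + y^2] and unit angular speed:
      [x' = x P(r,z)/2 - y,  y' = y P(r,z)/2 + x,  z' = r Q(r,z)].
    The degree is at most [2k + 2 <= m], and every cycle sweeps out an invariant
    torus.  A Floquet eigenvector of the cycle, corrected along the flow for the
    change of time, gives a solution of the variational equation that is
    multiplied by [mu] over a period; it spans the stable bundle ([|mu| < 1]) or
    the unstable one ([|mu| > 1]), with exponential rate [ln |mu| / T].  The
    tangent bundle is spanned by the field and the rotation, which stay bounded,
    so the tangential rate is [0]. *)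

(** * Calculus of one real variable *)

(** Rotating the planar field itself would require [x' = x P / (2 r)], which is not polynomial; the
    factor [r] clears the denominator and keeps the orbits. The price is that hyperbolicity is given
    in the original time, so the multiplier has to be carried through a reparametrization: a
    solution of the old variational equation solves the new one only after a multiple of the field
    is added, and that multiple can be made to scale by [mu] over a period because [mu] differs from
    1. Every object that the definition of a torus asks for is written down explicitly: the time
    change inverts a primitive of [1 / r], the solutions on the torus come from polar coordinates,
    and the fundamental matrices transport a frame of three known solutions. Uniqueness, through
    Gronwall, works in the plane, where it shows that the cycle closes up only at multiples of its
    period and that the Floquet solution stays transverse to the field. *)

Section Calculus.
Variable R : realType.
Implicit Types (f g : R -> R) (t x y : R).

Lemma is_derive1_eq f x (a b : R) : is_derive x 1 f a -> a = b -> is_derive x 1 f b.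
Proof. by move=> ? <-. Qed.

Lemma is_derive1_cst x (c : R) : is_derive x 1 (fun=> c) 0.
Proof. exact: is_derive_cst. Qed.

Lemma is_derive1D f g x a b : is_derive x 1 f a -> is_derive x 1 g b ->
  is_derive x 1 (fun t => f t + g t) (a + b).
Proof. exact: is_deriveD. Qed.

Lemma is_derive1B f g x a b : is_derive x 1 f a -> is_derive x 1 g b ->
  is_derive x 1 (fun t => f t - g t) (a - b).
Proof. exact: is_deriveB. Qed.

Lemma is_derive1N f x a : is_derive x 1 f a -> is_derive x 1 (fun t => - f t) (- a).
Proof. exact: is_deriveN. Qed.

Lemma is_derive1M f g x a b : is_derive x 1 f a -> is_derive x 1 g b ->
  is_derive x 1 (fun t => f t * g t) (a * g x + f x * b).
Proof.
move=> df dg; have h : is_derive x 1 (fun t => f t * g t) (f x *: b + g x *: a).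
  exact: is_deriveM.
by apply: is_derive1_eq h _; rewrite addrC mulrC.
Qed.

Lemma is_derive1Z f x c a : is_derive x 1 f a -> is_derive x 1 (fun t => c * f t) (c * a).
Proof.
move=> df; apply: is_derive1_eq (is_derive1M (is_derive1_cst x c) df) _.
by rewrite mul0r add0r.
Qed.

Lemma is_derive1X f x n a : is_derive x 1 f a ->
  is_derive x 1 (fun t => f t ^+ n) (n%:R * f x ^+ n.-1 * a).
Proof.
move=> df; have := @is_deriveX _ _ f n x 1 a df.
have -> : f ^+ n = fun t => f t ^+ n by apply/funext => t; rewrite exprfctE.
by [].
Qed.

Lemma is_derive1_shift f x c a : is_derive (x + c) 1 f a ->
  is_derive x 1 (fun t => f (t + c)) a.
Proof.
move=> df; have dc : is_derive x 1 (fun t => t + c) 1.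
  exact: is_derive1_eq (is_derive1D (is_derive_id x 1) (is_derive1_cst x c)) (addr0 _).
by have := @is_derive1_comp R f (fun t => t + c) x a 1 df dc; rewrite mulr1.
Qed.

Lemma is_derive1_sum (I : Type) (r : seq I) (P : pred I) (h : I -> R -> R) x
    (dh : I -> R) : (forall i, is_derive x 1 (h i) (dh i)) ->
  is_derive x 1 (fun t => \sum_(i <- r | P i) h i t) (\sum_(i <- r | P i) dh i).
Proof.
move=> H; elim: r => [|i r ih].
  rewrite big_nil (_ : (fun t => _) = (fun=> 0)); first exact: is_derive1_cst.
  by apply/funext => t; rewrite big_nil.
rewrite big_cons (_ : (fun t => _) = (fun t => if P i then
    h i t + \sum_(i <- r | P i) h i t else \sum_(i <- r | P i) h i t)); last first.
  by apply/funext => t; rewrite big_cons.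
by case: (P i) => //; exact: is_derive1D.
Qed.

Lemma is_derive1_prod (I : eqType) (r : seq I) (h : I -> R -> R) x
    (dh : I -> R) : uniq r -> (forall i, is_derive x 1 (h i) (dh i)) ->
  is_derive x 1 (fun t => \prod_(i <- r) h i t)
    (\sum_(j <- r) dh j * \prod_(i <- r | i != j) h i x).
Proof.
move=> + H; elim: r => [_|i r ih /= /andP[ir ur]].
  rewrite big_nil (_ : (fun t => _) = (fun=> 1)); first exact: is_derive1_cst.
  by apply/funext => t; rewrite big_nil.
rewrite (_ : (fun t => _) = (fun t => h i t * \prod_(i <- r) h i t)); last first.
  by apply/funext => t; rewrite big_cons.
apply: is_derive1_eq (is_derive1M (H i) (ih ur)) _.
rewrite [RHS]big_cons big_cons eqxx /=; congr (_ * _ + _).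
  rewrite big_seq_cond [RHS]big_seq_cond; apply: eq_bigl => j.
  by case: (boolP (j \in r)) => //= jr; apply/esym; apply: contraNneq ir => <-.
rewrite mulr_sumr [LHS]big_seq [RHS]big_seq; apply: eq_bigr => j jr.
have ij : i != j by apply: contraNneq ir => ->.
by rewrite [in RHS]big_cons ij mulrCA.
Qed.

Lemma is_derive1_continuous f x a : is_derive x 1 f a -> {for x, continuous f}.
Proof. by case=> /derivable1_diffP/differentiable_continuous. Qed.

Lemma derive_le0_nincr f (df : R -> R) : (forall x, is_derive x 1 f (df x)) ->
  (forall x, df x <= 0) -> forall x y, x <= y -> f y <= f x.
Proof.
move=> fdf df0 x y xy.
have [|z zxy e] := @MVT_segment _ f df _ _ xy.
- by apply/continuous_subspaceT => z; exact: is_derive1_continuous (fdf z).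
- by rewrite -subr_le0 e mulr_le0_ge0// ?subr_ge0.
Qed.

Lemma derive_gt0_incr f (df : R -> R) : (forall x, is_derive x 1 f (df x)) ->
  (forall x, 0 < df x) -> {mono f : x y / x <= y}.
Proof.
move=> fdf df0; apply: le_mono => x y xy.
have [|z zxy e] := @MVT _ f df _ _ xy.
- by apply/continuous_subspaceT => z; exact: is_derive1_continuous (fdf z).
- by rewrite -subr_gt0 e mulr_gt0// subr_gt0.
Qed.

(** * Gronwall estimates and uniqueness for planar systems *)

Lemma gronwall_eq0 (f df : R -> R) (L t0 : R) :
  (forall t, is_derive t 1 f (df t)) -> (forall t, `|df t| <= L * f t) ->
  (forall t, 0 <= f t) -> f t0 = 0 -> forall t, f t = 0.
Proof.
move=> Df dfb f0 ft0 t; apply/eqP; rewrite eq_le f0 andbT.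
(* The weight [expR (- L * s)] makes [f] nonincreasing and [expR (L * s)] makes it nondecreasing:
   the first settles the times after [t0], the second those before. *)
have De (c s : R) : is_derive s 1 (fun s : R => f s * expR (c * s))
    ((df s + c * f s) * expR (c * s)).
  have dc : is_derive s 1 (fun s : R => c * s) c.
    by apply: is_derive1_eq (is_derive1Z c (is_derive_id s 1)) (mulr1 _).
  apply: is_derive1_eq (is_derive1M (Df s) (is_derive1_comp (is_derive_expR (c * s)) dc)) _.
  by rewrite /=; ring.
have dfb' s : (- (L * f s) <= df s) && (df s <= L * f s) by rewrite -ler_norml.
have [tt0|/ltW tt0] := leP t0 t.
- have := @derive_le0_nincr _ _ (De (- L)) _ t0 t tt0.
  rewrite ft0 mul0r pmulr_lle0 ?expR_gt0//; apply=> s.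
  by rewrite pmulr_lle0 ?expR_gt0//; case/andP: (dfb' s) => _ ?; rewrite mulNr subr_le0.
- have := @derive_le0_nincr _ _ (fun s => is_derive1N (De L s)) _ t t0 tt0.
  rewrite ft0 mul0r oppr0 oppr_ge0 pmulr_lle0 ?expR_gt0//; apply=> s.
  rewrite oppr_le0 pmulr_lge0 ?expR_gt0//.
  by case/andP: (dfb' s) => ? _; rewrite -lerBlDr sub0r.
Qed.

Lemma gronwall2 (y1 y2 d1 d2 : R -> R) (L t0 : R) :
  (forall t, is_derive t 1 y1 (d1 t)) -> (forall t, is_derive t 1 y2 (d2 t)) ->
  (forall t, `|d1 t| <= L * (`|y1 t| + `|y2 t|)) ->
  (forall t, `|d2 t| <= L * (`|y1 t| + `|y2 t|)) ->
  y1 t0 = 0 -> y2 t0 = 0 -> forall t, y1 t = 0 /\ y2 t = 0.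
Proof.
move=> D1 D2 b1 b2 z1 z2 t.
pose f (t : R) := y1 t ^+ 2 + y2 t ^+ 2.
pose df (t : R) := 2 * (y1 t * d1 t + y2 t * d2 t).
have Df (s : R) : is_derive s 1 f (df s).
  by apply: is_derive1_eq (is_derive1D (is_derive1X 2 (D1 s)) (is_derive1X 2 (D2 s))) _;
     rewrite /df /=; ring.
have f0 s : 0 <= f s by rewrite addr_ge0// sqr_ge0.
suff ft0 : f t = 0.
  move/eqP: ft0; rewrite paddr_eq0 ?sqr_ge0// !sqrf_eq0.
  by move=> /andP[/eqP-> /eqP->].
(* The 4 is 2 times 2: one factor from differentiating squares, one from
   [(|y1| + |y2|)^2 <= 2 (y1^2 + y2^2)]. *)
apply: (@gronwall_eq0 f df (4 * L) t0 Df _ f0); last by rewrite /f z1 z2 expr0n addr0.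
move=> s; pose S : R := `|y1 s| + `|y2 s|.
have S0 : 0 <= S by rewrite addr_ge0.
have h : `|df s| <= 2 * (L * S ^+ 2).
  rewrite /df normrM ger0_norm// ler_wpM2l// (le_trans (ler_normD _ _))// !normrM.
  rewrite expr2 mulrA [leRHS]mulrC {1}/S mulrDl lerD// ler_wpM2l// ?b1 ?b2.
(* Nonnegativity of [L] is read off the bound wherever [S > 0]; where [S = 0] both [df s] and [f s]
   vanish. *)
have [y0|yn0] := eqVneq S 0.
  rewrite y0 expr0n !mulr0 in h; rewrite (le_trans h)//.
  move: y0 => /eqP; rewrite paddr_eq0// !normr_eq0 => /andP[/eqP y10 /eqP y20].
  by rewrite /f y10 y20 expr0n addr0 mulr0.
have Sp : 0 < S by rewrite lt0r yn0.
have Lp : 0 <= L by rewrite -(pmulr_lge0 _ Sp) (le_trans _ (b1 s)).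
have hf : S ^+ 2 <= 2 * f s.
  rewrite /f -(real_normK (num_real (y1 s))) -(real_normK (num_real (y2 s))) /S.
  rewrite -subr_ge0 (_ : _ - _ = (`|y1 s| - `|y2 s|) ^+ 2) ?sqr_ge0//; ring.
by rewrite (le_trans h)// (_ : 4 * L * f s = 2 * (L * (2 * f s))); [rewrite !ler_wpM2l|ring].
Qed.

Lemma linear2_uniq (a b c d y1 y2 : R -> R) (L t0 : R) :
  (forall t, [/\ `|a t| <= L, `|b t| <= L, `|c t| <= L & `|d t| <= L]) ->
  (forall t, is_derive t 1 y1 (a t * y1 t + b t * y2 t)) ->
  (forall t, is_derive t 1 y2 (c t * y1 t + d t * y2 t)) ->
  y1 t0 = 0 -> y2 t0 = 0 -> forall t, y1 t = 0 /\ y2 t = 0.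
Proof.
move=> bL D1 D2; apply: (@gronwall2 _ _ _ _ L t0 D1 D2) => t;
  have [? ? ? ?] := bL t;
  by rewrite (le_trans (ler_normD _ _))// !normrM mulrDr lerD// ler_wpM2r.
Qed.

(** * Periodic functions *)

Lemma periodic_int {U : Type} (f : R -> U) (T : R) : (forall t, f (t + T) = f t) ->
  forall (n : int) t, f (t + n%:~R * T) = f t.
Proof.
move=> fT; have nat (n : nat) t : f (t + n%:R * T) = f t.
  by elim: n => [|n ih]; rewrite ?mul0r ?addr0// mulrSr mulrDl mul1r addrA fT.
by case=> n t; [exact: nat | rewrite NegzE mulrNz mulNr -[LHS](nat n.+1) subrK].
Qed.

Lemma period_reduce (T t : R) : 0 < T ->
  exists n : int, exists s, [/\ t = s + n%:~R * T, 0 <= s & s < T].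
Proof.
move=> T0; exists (Num.floor (t / T)), (t - (Num.floor (t / T))%:~R * T).
rewrite subrK subr_ge0 -ler_pdivlMr// floor_le; split => //.
by rewrite ltrBlDl -[X in _ + X]mul1r -mulrDl -ltr_pdivrMr// -[1]/(1%:~R) -intrD floorD1_gt.
Qed.

Lemma periodic_bounded (f : R -> R) (T : R) : 0 < T -> continuous f ->
  (forall t, f (t + T) = f t) -> exists B : R, forall t, `|f t| <= B.
Proof.
move=> T0 cf fT.
have cn : {within `[0, T], continuous (fun t => `|f t|)}.
  apply: continuous_subspaceT => t; apply: continuous_comp; first exact: cf.
  exact: norm_continuous.
have [c _ H] := EVT_max (ltW T0) cn.
exists `|f c| => t; have [n [s [-> s0 sT]]] := period_reduce t T0.
by rewrite (periodic_int fT) H// in_itv/= s0 ltW.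
Qed.

Lemma periodic_lower_bound (f : R -> R) (T : R) : 0 < T -> continuous f ->
  (forall t, f (t + T) = f t) -> (forall t, 0 < f t) ->
  exists2 m, 0 < m & forall t, m <= f t.
Proof.
move=> T0 cf fT f0.
have cn : {within `[0, T], continuous f} by apply: continuous_subspaceT => t; exact: cf.
have [c _ H] := EVT_min (ltW T0) cn.
exists (f c) => // t; have [n [s [-> s0 sT]]] := period_reduce t T0.
by rewrite (periodic_int fT) H// in_itv/= s0 ltW.
Qed.

(** * Antiderivatives on the whole line and inverse functions *)

Lemma antiderivative_right (f : R -> R) : continuous f ->
  exists F : R -> R, forall t, -1 < t -> is_derive t 1 F (f t).
Proof.
(* Starting the integral at -1 gives a two-sided derivative at 0 as well, which leaves an overlap
   for gluing with the reflected primitive. *)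
move=> cf; exists (fun x => \int[lebesgue_measure]_(t in `[-1, x]) f t)%R => t t1.
have [||||d e] := @continuous_FTC1_closed R f (-1) t (t + 1).
- by rewrite ltrDl.
- apply: continuous_compact_integrable; first exact: segment_compact.
  by apply: continuous_subspaceT => z; exact: cf.
- by [].
- exact: cf.
- by apply: (DeriveDef d); rewrite -derive1E; exact: e.
Qed.

Lemma antiderivative (f : R -> R) : continuous f ->
  exists F : R -> R, forall t, is_derive t 1 F (f t).
Proof.
move=> cf; have [F dF] := antiderivative_right cf.
have [|G dG] := @antiderivative_right (fun t => f (- t)).
  by move=> t; apply: continuous_comp; [exact: oppr_continuous|exact: cf].
(* The reflected primitive serves the times below 1. The constant makes it agree with [F] at 0,
   hence on the overlap [(-1, 1)], where the difference has zero derivative. *)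
pose H t := - G (- t) + (F 0 + G 0).
have dH t : t < 1 -> is_derive t 1 H (f t).
  move=> t1; have dN : is_derive t 1 (fun s : R => - s) (-1).
    exact: is_derive1N (is_derive_id t 1).
  have dG' : is_derive (- t) 1 G (f t) by rewrite -[in f t](opprK t); apply: dG; rewrite ltrN2.
  apply: is_derive1_eq (is_derive1D (is_derive1N (is_derive1_comp dG' dN)) (is_derive1_cst _ _)) _.
  by rewrite mulrN1 opprK addr0.
have H0 : H 0 = F 0 by rewrite /H oppr0 addrCA addNr addr0.
have FH t : -1 < t -> t < 1 -> F t = H t.
  move=> t1 t2.
  pose D s := F s - H s.
  have dD (s : R) : -1 < s -> s < 1 -> is_derive s 1 D 0.
    by move=> s1 s2; apply: is_derive1_eq (is_derive1B (dF s s1) (dH s s2)) (subrr _).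
  suff : D t = D 0 by rewrite /D H0 subrr => /eqP; rewrite subr_eq0 => /eqP.
  have [t0|t0] := leP t 0.
  - have [||z _] := @MVT_segment _ D (fun=> 0) _ _ t0.
    + by move=> z; rewrite in_itv/= => /andP[? ?]; apply: dD; lra.
    + apply: derivable_within_continuous => z; rewrite in_itv/= => /andP[? ?].
      by have [] : is_derive z 1 D 0 by apply: dD; lra.
    + by rewrite mul0r => /eqP; rewrite subr_eq0 => /eqP.
  - have [||z _] := @MVT_segment _ D (fun=> 0) _ _ (ltW t0).
    + by move=> z; rewrite in_itv/= => /andP[? ?]; apply: dD; lra.
    + apply: derivable_within_continuous => z; rewrite in_itv/= => /andP[? ?].
      by have [] : is_derive z 1 D 0 by apply: dD; lra.
    + by rewrite mul0r => /eqP; rewrite subr_eq0 => /eqP.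
exists (fun t => if 0 <= t then F t else H t) => t.
have [t0|t0] := ltP t (1 / 2).
- apply: near_eq_is_derive (dH t _); last by lra.
  near=> s; have s1 : s < 1.
    near: s; apply: lt_nbhsl; lra.
  by case: ifPn => // s0; rewrite FH//; lra.
- apply: near_eq_is_derive (dF t _); last by lra.
  near=> s; have s1 : 0 < s.
    near: s; apply: lt_nbhsr; lra.
  by rewrite ltW.
Unshelve. all: by end_near. Qed.

Lemma incr_inverse (G g : R -> R) : (forall x, is_derive x 1 G (g x)) ->
  (forall x, 0 < g x) -> (forall y, exists x, G x = y) ->
  exists H : R -> R, [/\ cancel G H, cancel H G & forall y, is_derive y 1 H (g (H y))^-1].
Proof.
move=> dG g0 sG; have mG := derive_gt0_incr dG g0.
have [H HK] := choice sG.
have GK : cancel G H by move=> x; apply: (inc_inj mG); rewrite HK.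
exists H; split => // y.
rewrite -{1}(HK y); apply: (@is_derive_inverse R G H).
- by near=> z; exact: GK.
- by near=> z; exact: is_derive1_continuous (dG z).
- by rewrite gt_eqF.
Unshelve. all: by end_near. Qed.

End Calculus.

(** * Polynomial functions *)

Section Polynomials.
Variable R : realType.

(** Asking only that coefficients exist lets degrees be tracked through sums, products and
    compositions without computing any coefficient. *)
Definition polyfun (n k : nat) (f : 'rV[R]_n -> R) :=
  exists c : monom n k -> R, forall x, peval c x = f x.

Lemma polyfun_monomial n k (e : 'I_n -> nat) : (\sum_i e i <= k)%N ->
  polyfun k (fun x => \prod_i x ord0 i ^+ e i).
Proof.
move=> ek; have eik i : (e i < k.+1)%N.
  by rewrite ltnS (leq_trans _ ek)// (bigD1 i)//= leq_addr.
pose a0 : monom n k := [ffun i => Ordinal (eik i)].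
exists (fun a => (a == a0)%:R) => x; rewrite /peval (bigD1 a0)/=; last first.
  by rewrite /mdeg; under eq_bigr do rewrite ffunE /=.
rewrite eqxx mul1r [X in _ + X]big1 => [|a /andP[_ /negPf ->]]; last by rewrite mul0r.
by rewrite addr0; apply: eq_bigr => i _; rewrite ffunE.
Qed.

Lemma polyfun0 n k : polyfun k (fun _ : 'rV[R]_n => 0).
Proof. by exists (fun=> 0) => x; rewrite /peval big1// => a _; rewrite mul0r. Qed.

Lemma polyfunD n k (f g : 'rV[R]_n -> R) : polyfun k f -> polyfun k g ->
  polyfun k (fun x => f x + g x).
Proof.
move=> [c cf] [d dg]; exists (fun a => c a + d a) => x.
by rewrite -cf -dg /peval -big_split/=; apply: eq_bigr => a _; rewrite mulrDl.
Qed.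

Lemma polyfunZ n k (l : R) (f : 'rV[R]_n -> R) : polyfun k f ->
  polyfun k (fun x => l * f x).
Proof.
move=> [c cf]; exists (fun a => l * c a) => x.
by rewrite -cf /peval mulr_sumr; apply: eq_bigr => a _; rewrite mulrA.
Qed.

Lemma polyfun_ext n k (f g : 'rV[R]_n -> R) : f =1 g -> polyfun k f -> polyfun k g.
Proof. by move=> fg [c cf]; exists c => x; rewrite cf. Qed.

Lemma polyfun_sum n k (I : finType) (P : pred I) (f : I -> 'rV[R]_n -> R) :
  (forall i, P i -> polyfun k (f i)) -> polyfun k (fun x => \sum_(i | P i) f i x).
Proof.
move=> H; elim: (index_enum I) => [|i r ih].
  by apply: polyfun_ext (polyfun0 n k) => x; rewrite big_nil.
case Pi : (P i).
  by apply: polyfun_ext (polyfunD (H i Pi) ih) => x; rewrite big_cons Pi.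
by apply: polyfun_ext ih => x; rewrite big_cons Pi.
Qed.

Lemma polyfun_of_peval n k k' (c : monom n k -> R) : (k <= k')%N -> polyfun k' (peval c).
Proof.
move=> kk'; apply: polyfun_sum => a ak; apply: polyfunZ; apply: polyfun_monomial.
exact: leq_trans ak kk'.
Qed.

Lemma polyfun_leq n k k' (f : 'rV[R]_n -> R) : (k <= k')%N -> polyfun k f -> polyfun k' f.
Proof. by move=> kk' [c cf]; apply: polyfun_ext cf (polyfun_of_peval c kk'). Qed.

Lemma polyfun_cst n k (l : R) : polyfun k (fun _ : 'rV[R]_n => l).
Proof.
have h : (\sum_(i < n) 0 <= k)%N by rewrite big1.
apply: polyfun_ext (polyfunZ l (polyfun_monomial h)) => x.
by rewrite big1 ?mulr1// => i _; rewrite expr0.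
Qed.

Lemma polyfun_coord n (i : 'I_n) : polyfun 1 (fun x : 'rV[R]_n => x ord0 i).
Proof.
have h : (\sum_(j < n) (j == i) <= 1)%N.
  by rewrite (bigD1 i)//= eqxx big1 // => j /negPf ->.
apply: polyfun_ext (polyfun_monomial h) => x.
by rewrite (bigD1 i)//= eqxx expr1 big1 ?mulr1// => j /negPf ->; rewrite expr0.
Qed.

Lemma polyfunM n k l (f g : 'rV[R]_n -> R) : polyfun k f -> polyfun l g ->
  polyfun (k + l) (fun x => f x * g x).
Proof.
move=> [c cf] [d dg].
have : polyfun (k + l) (fun x => \sum_(a : monom n k | (mdeg a <= k)%N)
   \sum_(b : monom n l | (mdeg b <= l)%N)
     c a * d b * \prod_(i < n) x ord0 i ^+ (a i + b i)).
  apply: polyfun_sum => a ak; apply: polyfun_sum => b bl.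
  apply: polyfunZ; apply: polyfun_monomial.
  by rewrite big_split/=; exact: leq_add.
apply: polyfun_ext => x; rewrite -cf -dg /peval mulr_suml; apply: eq_bigr => a _.
rewrite mulr_sumr; apply: eq_bigr => b _.
by under eq_bigr do rewrite exprD; rewrite big_split /= mulrACA.
Qed.

Lemma polyfunX n k e (f : 'rV[R]_n -> R) : polyfun k f -> polyfun (k * e) (fun x => f x ^+ e).
Proof.
move=> pf; elim: e => [|e ih]; first by rewrite muln0; exact: polyfun_cst.
by rewrite mulnS; apply: polyfun_ext (polyfunM pf ih) => x; rewrite exprS.
Qed.

Lemma polyfun_comp n' n k d (c : monom n' k -> R) (g : 'rV[R]_n -> 'rV[R]_n') :
  (forall i, polyfun d (fun x => g x ord0 i)) -> polyfun (d * k) (fun x => peval c (g x)).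
Proof.
move=> pg; apply: polyfun_sum => a ak; apply: polyfunZ.
apply: (@polyfun_leq _ (\sum_(i < n') d * a i)%N); first by rewrite -big_distrr/= leq_mul2l ak orbT.
elim: (index_enum 'I_n') => [|i r ih].
  by apply: polyfun_ext (polyfun_cst n _ 1) => x; rewrite big_nil.
by rewrite big_cons; apply: polyfun_ext (polyfunM (polyfunX (a i) (pg i)) ih) => x; rewrite big_cons.
Qed.

(** This is what identifies the formal [pderiv] with the gradient of [peval]. The truncated exponent
    at [a j = 0] is harmless, since the factor [a j] vanishes there. *)
Lemma peval_chain n k (c : monom n k -> R) (g : R -> 'rV[R]_n) (dg : 'I_n -> R) (t : R) :
  (forall i, is_derive t 1 (fun s => g s ord0 i) (dg i)) ->
  is_derive t 1 (fun s => peval c (g s)) (\sum_j pderiv c j (g t) * dg j).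
Proof.
move=> H.
have Dm (a : monom n k) : is_derive t 1 (fun s => c a * \prod_(i < n) g s ord0 i ^+ a i)
    (\sum_j (c a * (a j : nat)%:R * \prod_(i < n) g t ord0 i ^+ (a i - (i == j))%N) * dg j).
  have := is_derive1_prod (index_enum_uniq 'I_n) (fun i => is_derive1X (a i) (H i)).
  move=> /(is_derive1Z (c a)) h; apply: is_derive1_eq h _.
  rewrite mulr_sumr; apply: eq_bigr => j _.
  rewrite [in RHS](bigD1 j)//= eqxx subn1.
  rewrite [in RHS](eq_bigr (fun i => g t ord0 i ^+ a i)); first by ring.
  by move=> i /negPf ->; rewrite subn0.
apply: is_derive1_eq (is_derive1_sum _ _ Dm) _.
rewrite exchange_big/=; apply: eq_bigr => j _.
by rewrite /pderiv mulr_suml.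
Qed.

Lemma continuous_sum (T : topologicalType) (I : Type) (r : seq I) (P : pred I)
    (h : I -> T -> R) : (forall i, continuous (h i)) ->
  continuous (fun t => \sum_(i <- r | P i) h i t).
Proof.
move=> H; elim: r => [|i r ih].
  rewrite (_ : (fun t => _) = (fun=> 0)); first by move=> t; exact: cvg_cst.
  by apply/funext => t; rewrite big_nil.
rewrite (_ : (fun t => _) = (fun t => if P i then
    h i t + \sum_(i <- r | P i) h i t else \sum_(i <- r | P i) h i t)); last first.
  by apply/funext => t; rewrite big_cons.
by case: (P i) => // t; apply: cvgD; [exact: H|exact: ih].
Qed.

Lemma continuous_prod (T : topologicalType) (I : Type) (r : seq I)
    (h : I -> T -> R) : (forall i, continuous (h i)) ->
  continuous (fun t => \prod_(i <- r) h i t).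
Proof.
move=> H; elim: r => [|i r ih].
  rewrite (_ : (fun t => _) = (fun=> 1)); first by move=> t; exact: cvg_cst.
  by apply/funext => t; rewrite big_nil.
rewrite (_ : (fun t => _) = (fun t => h i t * \prod_(i <- r) h i t)); last first.
  by apply/funext => t; rewrite big_cons.
by move=> t; apply: cvgM; [exact: H|exact: ih].
Qed.

Lemma continuous_expn (T : topologicalType) n (h : T -> R) : continuous h ->
  continuous (fun t => h t ^+ n).
Proof.
by move=> ch t; apply: (@continuous_comp _ _ _ h (fun x : R => x ^+ n)); [exact: ch|exact: exprn_continuous].
Qed.

Lemma peval_continuous (T : topologicalType) n k (c : monom n k -> R) (g : T -> 'rV[R]_n) :
  (forall i, continuous (fun s => g s ord0 i)) -> continuous (fun s => peval c (g s)).
Proof.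
move=> H; apply: continuous_sum => a t; apply: cvgM; first exact: cvg_cst.
by apply: continuous_prod => i; apply: continuous_expn.
Qed.

Lemma pderiv_continuous (T : topologicalType) n k (c : monom n k -> R) j (g : T -> 'rV[R]_n) :
  (forall i, continuous (fun s => g s ord0 i)) -> continuous (fun s => pderiv c j (g s)).
Proof.
move=> H; apply: continuous_sum => a t; apply: cvgM; first exact: cvg_cst.
by apply: continuous_prod => i; apply: continuous_expn.
Qed.

(** The bound [M] travels with the Lipschitz constant because the Lipschitz constant of a product
    involves bounds on the factors; this lets the property pass to polynomials by induction. *)
Definition loclip n (f : 'rV[R]_n -> R) := forall B : R, exists L M : R,
  forall x y : 'rV[R]_n, (forall i, `|x ord0 i| <= B) -> (forall i, `|y ord0 i| <= B) ->
  `|f x| <= M /\ `|f x - f y| <= L * \sum_i `|x ord0 i - y ord0 i|.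

Lemma loclip_ext n (f g : 'rV[R]_n -> R) : f =1 g -> loclip f -> loclip g.
Proof. by move=> /funext ->. Qed.

Lemma loclip_cst n (l : R) : loclip (fun _ : 'rV[R]_n => l).
Proof. by move=> B; exists 0, `|l| => x y _ _; rewrite subrr normr0 mul0r. Qed.

Lemma loclip_coord n (i : 'I_n) : loclip (fun x : 'rV[R]_n => x ord0 i).
Proof.
move=> B; exists 1, B => x y xB yB; split; first exact: xB.
by rewrite mul1r (bigD1 i)//= lerDl sumr_ge0.
Qed.

Lemma loclipD n (f g : 'rV[R]_n -> R) : loclip f -> loclip g -> loclip (fun x => f x + g x).
Proof.
move=> lf lg B; have [L [M H]] := lf B; have [L' [M' H']] := lg B.
exists (L + L'), (M + M') => x y xB yB.
have [h1 h2] := H _ _ xB yB; have [h1' h2'] := H' _ _ xB yB; split.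
  by rewrite (le_trans (ler_normD _ _))// lerD.
by rewrite opprD addrACA (le_trans (ler_normD _ _))// mulrDl lerD.
Qed.

Lemma loclipM n (f g : 'rV[R]_n -> R) : loclip f -> loclip g -> loclip (fun x => f x * g x).
Proof.
move=> lf lg B; have [L [M H]] := lf B; have [L' [M' H']] := lg B.
exists (M * L' + M' * L), (M * M') => x y xB yB.
have [h1 h2] := H _ _ xB yB; have [h1' h2'] := H' _ _ xB yB.
have [h3 _] := H' _ _ yB xB; split; first by rewrite normrM ler_pM.
rewrite (_ : _ - _ = f x * (g x - g y) + g y * (f x - f y)); last by ring.
rewrite (le_trans (ler_normD _ _))// mulrDl !normrM -!mulrA lerD// ler_pM//.
Qed.

Lemma loclip_peval n k (c : monom n k -> R) : loclip (peval c).
Proof.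
rewrite /peval; elim: (index_enum (monom n k)) => [|a r ih].
  by apply: loclip_ext (loclip_cst n 0) => x; rewrite big_nil.
case Pa : (mdeg a <= k)%N; last by apply: loclip_ext ih => x; rewrite big_cons Pa.
suff ha : loclip (fun x => c a * \prod_(i < n) x ord0 i ^+ a i).
  by apply: loclip_ext (loclipD ha ih) => x; rewrite big_cons Pa.
apply: loclipM; first exact: loclip_cst.
elim: (index_enum 'I_n) => [|i s ih'].
  by apply: loclip_ext (loclip_cst n 1) => x; rewrite big_nil.
suff hi : loclip (fun x => x ord0 i ^+ a i).
  by apply: loclip_ext (loclipM hi ih') => x; rewrite big_cons.
elim: (nat_of_ord (a i)) => [|e ihe]; first exact: loclip_cst.
by apply: loclip_ext (loclipM (loclip_coord i) ihe) => x; rewrite exprS.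
Qed.

End Polynomials.

(** * Hyperbolic planar cycles *)

Section Planar.
Variable R : realType.

(** The function [F (t + T) - mu * F t] has zero derivative. For [mu = 1] the constant is the drift
    of a primitive over a period; for the Floquet multiplier it is the defect that a constant of
    integration can absorb. *)
Lemma zero_derive_shift (F f : R -> R) (T mu : R) :
  (forall t : R, is_derive t 1 F (f t)) -> (forall t, f (t + T) = mu * f t) ->
  forall t, F (t + T) = mu * F t + (F T - mu * F 0).
Proof.
move=> dF fT t.
have dD (s : R) : is_derive s 1 (fun s : R => F (s + T) - mu * F s) 0.
  apply: is_derive1_eq (is_derive1B (is_derive1_shift (dF (s + T))) (is_derive1Z mu (dF s))) _.
  by rewrite fT subrr.
have := @is_derive_0_is_cst R _ t 0 dD.
by rewrite /= add0r => /eqP; rewrite subr_eq => /eqP ->; rewrite addrC.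
Qed.

(** Separation of variables: [tau] is the inverse of a primitive [G] of [1 / g]. Over each period
    [G] grows by the fixed amount [G T], so it is unbounded in both directions, hence onto, and
    [G T] is the new period. *)
Lemma periodic_time_change (g : R -> R) (T : R) : 0 < T -> continuous g ->
  (forall t, 0 < g t) -> (forall t, g (t + T) = g t) ->
  exists (tau : R -> R) (T1 : R), [/\ 0 < T1, forall t : R, is_derive t 1 tau (g (tau t)),
    forall t, tau (t + T1) = tau t + T & bijective tau].
Proof.
move=> T0 cg g0 gT.
have [|F dF] := @antiderivative R (fun t => (g t)^-1).
  by move=> t; apply: cvgV; [rewrite gt_eqF|exact: cg].
pose G t := F t - F 0.
have dG (t : R) : is_derive t 1 G (g t)^-1.
  by apply: is_derive1_eq (is_derive1B (dF t) (is_derive1_cst t _)) (subr0 _).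
have Vg0 t : 0 < (g t)^-1 by rewrite invr_gt0.
have mG := derive_gt0_incr dG Vg0.
have G0 : G 0 = 0 by rewrite /G subrr.
have GT t : G (t + T) = G t + G T.
  have := @zero_derive_shift G (fun t => (g t)^-1) T 1 dG _ t.
  by rewrite !mul1r G0 subr0; apply=> s; rewrite gT mul1r.
have T1 : 0 < G T by rewrite -G0 (leW_mono mG).
have Gn (n : nat) : G (n%:R * T) = n%:R * G T.
  by elim: n => [|n ih]; rewrite ?mul0r// !mulrSr !mulrDl !mul1r GT ih.
have Gm (n : nat) : G (- (n%:R * T)) = - (n%:R * G T).
  elim: n => [|n ih]; first by rewrite !mul0r oppr0.
  apply: (addIr (G T)); rewrite -GT !mulrSr !mulrDl !mul1r opprD.
  by rewrite -addrA addNr addr0 ih opprD -addrA addNr addr0.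
have sG y : exists x, G x = y.
  pose n := Num.bound `|y / G T|.
  have yn : `|y / G T| < n%:R by apply: archi_boundP.
  have nT : - (n%:R * T) <= n%:R * T.
    have : 0 <= n%:R * T by rewrite mulr_ge0// ltW.
    lra.
  have [|| x _ xy] := @IVT R G _ _ y nT.
  - by apply: continuous_subspaceT => z; exact: is_derive1_continuous (dG z).
  - rewrite Gn Gm; move: yn; rewrite normrM normfV (gtr0_norm T1) ltr_pdivrMr// ltr_norml => /andP[y1 y2].
    by rewrite ge_min le_max (ltW y1) (ltW y2) orbT.
  - by exists x.
have [tau [tK Kt dt]] := incr_inverse dG Vg0 sG.
exists tau, (G T); split => //.
- by move=> t; apply: is_derive1_eq (dt t) _; rewrite invrK.
- by move=> t; apply: (can_inj tK); rewrite GT !Kt.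
- by exists G.
Qed.

(* [pr] and [pz] are the partial derivatives of [p], in a form that composes
   with curves. *)
Definition planar_C1 (p pr pz : R -> R -> R) :=
  [/\ forall (u v : R -> R) (t du dv : R), is_derive t 1 u du -> is_derive t 1 v dv ->
        is_derive t 1 (fun s => p (u s) (v s)) (pr (u t) (v t) * du + pz (u t) (v t) * dv),
      forall (T : topologicalType) (u v : T -> R), continuous u -> continuous v ->
        [/\ continuous (fun s => p (u s) (v s)), continuous (fun s => pr (u s) (v s))
          & continuous (fun s => pz (u s) (v s))]
    & forall B, exists L, forall u v u' v', `|u| <= B -> `|v| <= B -> `|u'| <= B -> `|v'| <= B ->
        `|p u v - p u' v'| <= L * (`|u - u'| + `|v - v'|)].

Section Cycle.
Variables p pr pz q qr qz : R -> R -> R.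
Hypotheses (Cp : planar_C1 p pr pz) (Cq : planar_C1 q qr qz).

Definition planar_sol (r z : R -> R) := forall t : R,
  is_derive t 1 r (p (r t) (z t)) /\ is_derive t 1 z (q (r t) (z t)).

Definition planar_var (r z e1 e2 : R -> R) := forall t : R,
  is_derive t 1 e1 (pr (r t) (z t) * e1 t + pz (r t) (z t) * e2 t) /\
  is_derive t 1 e2 (qr (r t) (z t) * e1 t + qz (r t) (z t) * e2 t).

Variables (r z : R -> R) (T : R).
Hypotheses (rz : planar_sol r z) (T0 : 0 < T)
  (rT : forall t, r (t + T) = r t) (zT : forall t, z (t + T) = z t)
  (min : forall s : R, 0 < s -> s < T -> r s = r 0 -> z s = z 0 -> False).

Lemma sol_continuous : continuous r /\ continuous z.
Proof. by split=> t; [exact: is_derive1_continuous (rz t).1|exact: is_derive1_continuous (rz t).2]. Qed.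

(** Along a periodic orbit the coefficients are continuous and periodic, hence bounded, so one
    Gronwall constant works for all times. *)
Lemma planar_var_uniq (e1 e2 : R -> R) (t0 : R) : planar_var r z e1 e2 ->
  e1 t0 = 0 -> e2 t0 = 0 -> forall t, e1 t = 0 /\ e2 t = 0.
Proof.
move=> De; have [cr cz] := sol_continuous.
have [_ /(_ _ _ _ cr cz)[_ c1 c2] _] := Cp.
have [_ /(_ _ _ _ cr cz)[_ c3 c4] _] := Cq.
have [|B1 b1] := periodic_bounded T0 c1; first by move=> t; rewrite rT zT.
have [|B2 b2] := periodic_bounded T0 c2; first by move=> t; rewrite rT zT.
have [|B3 b3] := periodic_bounded T0 c3; first by move=> t; rewrite rT zT.
have [|B4 b4] := periodic_bounded T0 c4; first by move=> t; rewrite rT zT.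
apply: (@linear2_uniq _ _ _ _ _ _ _ (B1 + B2 + B3 + B4) t0 _ (fun t => (De t).1) (fun t => (De t).2)) => t.
have h1 := b1 t; have h2 := b2 t; have h3 := b3 t; have h4 := b4 t.
have g1 := le_trans (normr_ge0 _) h1; have g2 := le_trans (normr_ge0 _) h2.
have g3 := le_trans (normr_ge0 _) h3; have g4 := le_trans (normr_ge0 _) h4.
by split; lra.
Qed.

Lemma planar_var_lin (e1 e2 f1 f2 : R -> R) (al be : R) :
  planar_var r z e1 e2 -> planar_var r z f1 f2 ->
  planar_var r z (fun t => al * e1 t + be * f1 t) (fun t => al * e2 t + be * f2 t).
Proof.
move=> De Df t; split.
  apply: is_derive1_eq (is_derive1D (is_derive1Z al (De t).1) (is_derive1Z be (Df t).1)) _.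
  ring.
apply: is_derive1_eq (is_derive1D (is_derive1Z al (De t).2) (is_derive1Z be (Df t).2)) _.
ring.
Qed.

Lemma planar_var_shift (e1 e2 : R -> R) : planar_var r z e1 e2 ->
  planar_var r z (fun t => e1 (t + T)) (fun t => e2 (t + T)).
Proof.
by move=> De t; have [h1 h2] := De (t + T); split; rewrite -(rT t) -(zT t); exact: is_derive1_shift.
Qed.

Lemma planar_var_field : planar_var r z (fun t => p (r t) (z t)) (fun t => q (r t) (z t)).
Proof.
by move=> t; have [D1 D2] := rz t; split; [case: Cp|case: Cq] => + _ _; apply.
Qed.

(** The field along the orbit solves the variational equation, so a zero would spread to all times
    and make the orbit constant, against minimality of the period at [T / 2]. *)
Lemma planar_field_neq0 (t : R) : p (r t) (z t) = 0 -> q (r t) (z t) = 0 -> False.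
Proof.
move=> p0 q0; have f0 := planar_var_uniq planar_var_field p0 q0.
apply: (min (s := T / 2)).
- by rewrite divr_gt0.
- by rewrite ltr_pdivrMr// ltr_pMr// ltr1n.
- by apply: is_derive_0_is_cst => s; apply: is_derive1_eq (rz s).1 (f0 s).1.
- by apply: is_derive_0_is_cst => s; apply: is_derive1_eq (rz s).2 (f0 s).2.
Qed.

(** Two time shifts of the orbit that meet once coincide, by Gronwall with a Lipschitz constant on a
    box containing the orbit. Reduced modulo [T], the difference [t1 - t2] is then a return time,
    and minimality makes it 0. *)
Lemma planar_inj (t1 t2 : R) : r t1 = r t2 -> z t1 = z t2 ->
  exists n : int, t1 = t2 + n%:~R * T.
Proof.
move=> rE zE; have [cr cz] := sol_continuous.
have [B1 b1] := periodic_bounded T0 cr rT.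
have [B2 b2] := periodic_bounded T0 cz zT.
have bB t : `|r t| <= B1 + B2 /\ `|z t| <= B1 + B2.
  have h1 := b1 t; have h2 := b2 t.
  have g1 := le_trans (normr_ge0 _) h1; have g2 := le_trans (normr_ge0 _) h2.
  by split; lra.
have [_ _ /(_ (B1 + B2))[L1 l1]] := Cp.
have [_ _ /(_ (B1 + B2))[L2 l2]] := Cq.
pose y1 (t : R) := r (t + t1) - r (t + t2).
pose y2 (t : R) := z (t + t1) - z (t + t2).
have D1 (t : R) : is_derive t 1 y1 (p (r (t + t1)) (z (t + t1)) - p (r (t + t2)) (z (t + t2))).
  by apply: is_derive1B; apply: is_derive1_shift; exact: (rz _).1.
have D2 (t : R) : is_derive t 1 y2 (q (r (t + t1)) (z (t + t1)) - q (r (t + t2)) (z (t + t2))).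
  by apply: is_derive1B; apply: is_derive1_shift; exact: (rz _).2.
have y0 : forall t, y1 t = 0 /\ y2 t = 0.
  apply: (@gronwall2 _ _ _ _ _ (`|L1| + `|L2|) 0 D1 D2).
  - move=> t; rewrite (le_trans (l1 _ _ _ _ _ _ _ _)) ?(bB _).1 ?(bB _).2//.
    by rewrite ler_wpM2r ?addr_ge0// (le_trans (ler_norm _))// lerDl.
  - move=> t; rewrite (le_trans (l2 _ _ _ _ _ _ _ _)) ?(bB _).1 ?(bB _).2//.
    by rewrite ler_wpM2r ?addr_ge0// (le_trans (ler_norm _))// lerDr.
  - by rewrite /y1 !add0r rE subrr.
  - by rewrite /y2 !add0r zE subrr.
have [n [s [st s0 sT]]] := period_reduce (t1 - t2) T0.
exists n; suff s00 : s = 0 by move: st; rewrite s00 add0r => <-; rewrite addrC subrK.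
move: s0; rewrite le_eqVlt => /predU1P[<-//|s0]; exfalso.
have [/eqP + /eqP] := y0 (- t2); rewrite /y1 /y2 addNr (addrC (- t2)) st.
rewrite (periodic_int rT) (periodic_int zT) !subr_eq0 => /eqP ? /eqP ?.
exact: min s0 sT _ _.
Qed.

Variables (e1 e2 : R -> R) (mu : R).
Hypotheses (De : planar_var r z e1 e2) (e1T : e1 T = mu * e1 0) (e2T : e2 T = mu * e2 0)
  (e0 : ~ (e1 0 = 0 /\ e2 0 = 0)) (mu1 : `|mu| != 1).

Lemma planar_mult t : e1 (t + T) = mu * e1 t /\ e2 (t + T) = mu * e2 t.
Proof.
have := planar_var_uniq (t0 := 0) (planar_var_lin 1 (- mu) (planar_var_shift De) De).
rewrite /= !add0r e1T e2T !mul1r !mulNr !subrr => /(_ erefl erefl t).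
by rewrite !mul1r !mulNr => -[/eqP + /eqP]; rewrite !subr_eq0 => /eqP-> /eqP->.
Qed.

Lemma planar_mult_neq0 : mu != 0.
Proof.
apply/eqP => mu0; apply: e0.
by apply: (planar_var_uniq (t0 := T) De); rewrite ?e1T ?e2T mu0 mul0r.
Qed.

(** If the Floquet solution [e] were parallel to the field at one time, a combination of the two
    with coefficient [al != 0] on [e] would vanish there, hence always. Comparing times 0 and [T],
    where the field agrees, leaves [al * (mu - 1) * e 0 = 0]. *)
Lemma planar_transverse t : e1 t * q (r t) (z t) - e2 t * p (r t) (z t) != 0.
Proof.
apply/eqP => d0.
have [al [be [al0 h1 h2]]] : exists al be, [/\ al != 0,
    al * e1 t + be * p (r t) (z t) = 0 & al * e2 t + be * q (r t) (z t) = 0].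
  have [f10|f1] := eqVneq (p (r t) (z t)) 0.
    have [f20|f2] := eqVneq (q (r t) (z t)) 0; first by case: (planar_field_neq0 f10 f20).
    exists (q (r t) (z t)), (- e2 t); split => //; last by ring.
    by rewrite -d0; ring.
  exists (p (r t) (z t)), (- e1 t); split => //; first by ring.
  by rewrite -[LHS]opprK -[in RHS]oppr0 -d0; congr (- _); ring.
have H := planar_var_uniq (planar_var_lin al be De planar_var_field) h1 h2.
have [+ +] := H T; have [+ +] := H 0 => /=.
rewrite e1T e2T -(add0r T) rT zT => a1 a2 a3 a4.
have k1 : al * ((mu - 1) * e1 0) = 0.
  by transitivity ((al * (mu * e1 0) + be * p (r 0) (z 0)) - (al * e1 0 + be * p (r 0) (z 0)));
     [ring|rewrite a1 a3 subrr].
have k2 : al * ((mu - 1) * e2 0) = 0.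
  by transitivity ((al * (mu * e2 0) + be * q (r 0) (z 0)) - (al * e2 0 + be * q (r 0) (z 0)));
     [ring|rewrite a2 a4 subrr].
have m1 : mu - 1 != 0 by rewrite subr_eq0; apply: contraNneq mu1 => ->; rewrite normr1.
apply: e0; split; apply/eqP; [move/eqP: k1|move/eqP: k2];
  by rewrite !mulf_eq0 (negPf al0) (negPf m1).
Qed.

End Cycle.

(* The data of a hyperbolic cycle of [a' = a p(a^2,z)/2, z' = a^2 q(a^2,z)]: the
   planar field [(p,q)], multiplied by [r], in the coordinate [a = sqrt r]; [(b,d)]
   solves the variational equation and is multiplied by [mu] over a period. *)
Definition lifted_cycle (p pr pz q qr qz : R -> R -> R) (a z b d : R -> R) (T mu : R) :=
  [/\ 0 < T, mu != 0, `|mu| != 1 & forall t : R,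
    [/\ [/\ 0 < a t, is_derive t 1 a (a t * p (a t ^+ 2) (z t) / 2)
          & is_derive t 1 z (a t ^+ 2 * q (a t ^+ 2) (z t))],
        is_derive t 1 b (b t * p (a t ^+ 2) (z t) / 2 + a t *
          (pr (a t ^+ 2) (z t) * (2 * a t * b t) + pz (a t ^+ 2) (z t) * d t) / 2),
        is_derive t 1 d (2 * a t * b t * q (a t ^+ 2) (z t) + a t ^+ 2 *
          (qr (a t ^+ 2) (z t) * (2 * a t * b t) + qz (a t ^+ 2) (z t) * d t)),
        [/\ a (t + T) = a t, z (t + T) = z t, b (t + T) = mu * b t & d (t + T) = mu * d t]
      & b t * (a t ^+ 2 * q (a t ^+ 2) (z t)) - d t * (a t * p (a t ^+ 2) (z t) / 2) != 0]] /\
  (forall t1 t2, a t1 = a t2 -> z t1 = z t2 -> exists n : int, t1 = t2 + n%:~R * T).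

Lemma lifted_cycle_exists (p pr pz q qr qz : R -> R -> R) (r z e1 e2 : R -> R) (T mu : R) :
  planar_C1 p pr pz -> planar_C1 q qr qz -> planar_sol p q r z -> 0 < T ->
  (forall t, r (t + T) = r t) -> (forall t, z (t + T) = z t) ->
  (forall s : R, 0 < s -> s < T -> r s = r 0 -> z s = z 0 -> False) ->
  planar_var pr pz qr qz r z e1 e2 -> e1 T = mu * e1 0 -> e2 T = mu * e2 0 ->
  ~ (e1 0 = 0 /\ e2 0 = 0) -> `|mu| != 1 -> (forall t, 0 < r t) ->
  exists a z' b d T' tau, [/\ lifted_cycle p pr pz q qr qz a z' b d T' mu,
    bijective tau & forall t, a t ^+ 2 = r (tau t) /\ z' t = z (tau t)].
Proof.
move=> Cp Cq rz T0 rT zT min De e1T e2T e0 mu1 r0.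
have [cr cz] := sol_continuous rz.
have [tau [T1 [T10 dtau tauT tau_bij]]] := periodic_time_change T0 cr r0 rT.
have mu0 := planar_mult_neq0 Cp Cq rz T0 rT zT De e1T e2T e0.
have eT := planar_mult Cp Cq rz T0 rT zT De e1T e2T.
have tr := planar_transverse Cp Cq rz T0 rT zT min De e1T e2T e0 mu1.
have inj := planar_inj Cp Cq rz T0 rT zT min.
(* Write [F = (p, q)]. Along the reparametrized orbit, [e + beta * r * F] solves the variational
   equation of [r * F] exactly when, in the original time, [beta' = e1 / r ^+ 2]. *)
have [|B dB] := @antiderivative R (fun t => e1 t / r t ^+ 2).
  move=> t; apply: cvgM; first exact: is_derive1_continuous (De t).1.
  apply: cvgV; first by rewrite expf_neq0// gt_eqF.
  by apply: continuous_expn; exact: cr.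
have mu_1 : mu - 1 != 0 by rewrite subr_eq0; apply: contraNneq mu1 => ->; rewrite normr1.
(* [beta0] makes the flow-component [beta] of the transverse solution
   multiplied by [mu] over a period. *)
pose beta0 := (B T - mu * B 0) / (mu - 1).
pose beta (t : R) : R := B t + beta0.
have dbeta (t : R) : is_derive t 1 beta (e1 t / r t ^+ 2).
  by apply: is_derive1_eq (is_derive1D (dB t) (is_derive1_cst t _)) (addr0 _).
have betaT t : beta (t + T) = mu * beta t.
  rewrite /beta (zero_derive_shift (mu := mu) dB); last by move=> s; rewrite rT (eT s).1 mulrA.
  by rewrite /beta0; field.
pose a (t : R) : R := Num.sqrt (r (tau t)).
have a2 t : a t ^+ 2 = r (tau t) by rewrite sqr_sqrtr// ltW.
have a0 t : 0 < a t by rewrite sqrtr_gt0.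
have an0 t : a t != 0 by rewrite gt_eqF.
pose P (t : R) : R := p (r (tau t)) (z (tau t)); pose Q (t : R) : R := q (r (tau t)) (z (tau t)).
have dcomp (f : R -> R) (df t : R) : is_derive (tau t) 1 f df ->
    is_derive t 1 (fun s : R => f (tau s)) (df * a t ^+ 2).
  by move=> h; rewrite a2; exact: is_derive1_comp h (dtau t).
have da (t : R) : is_derive t 1 a (a t * P t / 2).
  have h := is_derive1_comp (is_derive1_sqrt (r0 (tau t))) (dcomp _ _ _ (rz (tau t)).1).
  by apply: is_derive1_eq h _; rewrite -/(P t) -/(a t); field; rewrite ?an0.
have dVa (t : R) : is_derive t 1 (fun s : R => (a s)^-1) (- P t / (2 * a t)).
  by apply: is_derive1_eq (is_deriveV (an0 t) (da t)) _; rewrite /GRing.scale/=; field; rewrite ?an0.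
have dz (t : R) : is_derive t 1 (fun s : R => z (tau s)) (a t ^+ 2 * Q t).
  by apply: is_derive1_eq (dcomp _ _ _ (rz (tau t)).2) _; rewrite mulrC.
have dP (t : R) := dcomp _ _ _ (planar_var_field Cp Cq rz (tau t)).1.
have dQ (t : R) := dcomp _ _ _ (planar_var_field Cp Cq rz (tau t)).2.
have dE1 (t : R) := dcomp _ _ _ (De (tau t)).1.
have dE2 (t : R) := dcomp _ _ _ (De (tau t)).2.
have dbe (t : R) := dcomp _ _ _ (dbeta (tau t)).
(* The corrected solution in the coordinate [a]: a variation of [r = a ^+ 2] is [2 * a] times a
   variation of [a], so the first component is divided by [2 * a]. *)
pose b (t : R) : R := e1 (tau t) * (a t)^-1 / 2 + beta (tau t) * a t * P t / 2.
pose d (t : R) : R := e2 (tau t) + beta (tau t) * a t ^+ 2 * Q t.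
exists a, (z \o tau), b, d, T1, tau; split => //; split; last first.
  move=> t1 t2 /(congr1 (fun x => x ^+ 2)); rewrite !a2 => rE /= zE.
  have [n tn] := inj _ _ rE zE; exists n; apply: (bij_inj tau_bij).
  (* Removing the linear drift from [tau] leaves a function of period [T1], which gives the effect
     of any integer number of periods. *)
  have : tau (t2 + n%:~R * T1) - (t2 + n%:~R * T1) * (T / T1) = tau t2 - t2 * (T / T1).
    apply: (@periodic_int _ _ (fun t => tau t - t * (T / T1))) => t.
    by rewrite tauT; field; rewrite gt_eqF.
  move=> h; rewrite tn -[RHS](subrK ((t2 + n%:~R * T1) * (T / T1))) h.
  by field; rewrite gt_eqF.
split => // t; rewrite !a2 /= -/(P t) -/(Q t); split.
- by split => //; rewrite -a2; exact: dz.
- have h := is_derive1D (is_derive1M (is_derive1M (dE1 t) (dVa t)) (is_derive1_cst t 2^-1))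
    (is_derive1M (is_derive1M (is_derive1M (dbe t) (da t)) (dP t)) (is_derive1_cst t 2^-1)).
  apply: is_derive1_eq h _; rewrite /b /d -/(P t) -/(Q t) -a2.
  by field; rewrite ?an0.
- have h := is_derive1D (dE2 t) (is_derive1M (is_derive1M (dbe t) (is_derive1X 2 (da t))) (dQ t)).
  apply: is_derive1_eq h _; rewrite /b /d -/(P t) -/(Q t) -a2 /=.
  by field; rewrite ?an0.
- rewrite /b /d /P /Q /a /= tauT !rT !zT !betaT !(eT _).1 !(eT _).2; split => //; ring.
(* The correction is a multiple of the field and drops out of the determinant; the factor [a / 2]
   combines the time change with the change of coordinate. *)
- have -> : b t * (r (tau t) * Q t) - d t * (a t * P t / 2) =
     (a t / 2) * (e1 (tau t) * Q t - e2 (tau t) * P t).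
    by rewrite /b /d -a2; field; rewrite ?an0.
  by rewrite !mulf_neq0// invr_neq0.
Qed.

End Planar.

(** * Matrices and polar coordinates *)

Section MatrixCalculus.
Variable R : realType.

Lemma derive1_mx m n (M : R -> 'M[R]_(m, n)) (dM : 'M[R]_(m, n)) (t : R) :
  (forall i j, is_derive t 1 (fun s : R => M s i j) (dM i j)) ->
  derivable M t 1 /\ derive1 M t = dM.
Proof.
move=> H; have dM' : derivable M t 1.
  by apply/derivable_mxP => i j; have [] := H i j.
split => //; rewrite derive1E derive_mx//; apply/matrixP => i j; rewrite mxE.
by have [_ ->] := H i j.
Qed.

Lemma is_derive1_mx m n (M : R -> 'M[R]_(m, n)) (t : R) i j : derivable M t 1 ->
  is_derive t 1 (fun s : R => M s i j) (derive1 M t i j).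
Proof.
move=> dM; rewrite derive1E derive_mx// mxE; apply: derivableP.
by have /derivable_mxP := dM; apply.
Qed.

Lemma continuous_mx (T : topologicalType) m n (F : T -> 'M[R]_(m, n)) :
  (forall i j, continuous (fun x => F x i j)) -> continuous F.
Proof.
move=> H x A [P FP PA]; rewrite /nbhs/=.
have : \forall y \near x, forall i j, P i j (F y i j).
  apply: filter_forall => i; apply: filter_forall => j.
  exact: H (FP i j).
by apply: filterS => y Py; exact: PA.
Qed.

(** Reads the Jacobian off directional derivatives of the values, so that it can be computed for a
    field whose coefficients are known only to exist. *)
Lemma Jac_direction n k (c : 'I_n -> monom n k -> R) (x : 'rV[R]_n) (w : 'cV[R]_n) i :
  is_derive (0 : R) 1 (fun s : R => peval (c i) (x + s *: w^T)) ((Jac c x *m w) i ord0).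
Proof.
have h j : is_derive (0 : R) 1 (fun s : R => (x + s *: w^T) ord0 j) (w j ord0).
  rewrite (_ : (fun s : R => _) = (fun s : R => x ord0 j + w j ord0 * s)); last first.
    by apply/funext => s; rewrite !mxE mulrC.
  apply: is_derive1_eq (is_derive1D (is_derive1_cst _ _) (is_derive1Z _ (is_derive_id _ _))) _.
  by rewrite add0r mulr1.
apply: is_derive1_eq (peval_chain (c i) h) _.
by rewrite mxE; apply: eq_bigr => j _; rewrite scale0r addr0 mxE.
Qed.

Lemma is_derive1_unique (f : R -> R) (x a b : R) : is_derive x 1 f a -> is_derive x 1 f b -> a = b.
Proof. by case=> _ <- [_ <-]. Qed.

Definition row3 (x y z : R) : 'rV[R]_3 := \row_(i < 3) nth 0 [:: x; y; z] i.

Definition o0 : 'I_3 := @Ordinal 3 0 isT.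
Definition o1 : 'I_3 := @Ordinal 3 1 isT.
Definition o2 : 'I_3 := @Ordinal 3 2 isT.

Lemma forall_I3 (P : 'I_3 -> Prop) : P o0 -> P o1 -> P o2 -> forall i, P i.
Proof.
move=> P0 P1 P2 [[|[|[|//]]] i3].
- by rewrite (_ : Ordinal _ = o0)//; exact: val_inj.
- by rewrite (_ : Ordinal _ = o1)//; exact: val_inj.
- by rewrite (_ : Ordinal _ = o2)//; exact: val_inj.
Qed.

Lemma sum3 (F : 'I_3 -> R) : \sum_i F i = F o0 + F o1 + F o2.
Proof.
rewrite !big_ord_recr big_ord0 /= add0r.
by congr (F _ + F _ + F _); apply: val_inj.
Qed.

Lemma row3_eta (w : 'rV[R]_3) : w = row3 (w ord0 o0) (w ord0 o1) (w ord0 o2).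
Proof. by apply/rowP; apply: forall_I3; rewrite mxE. Qed.

Lemma row3_inj x y z x' y' z' : row3 x y z = row3 x' y' z' -> [/\ x = x', y = y' & z = z'].
Proof. by move=> /rowP h; split; [have := h o0|have := h o1|have := h o2]; rewrite !mxE. Qed.

Lemma row3D x y z x' y' z' : row3 x y z + row3 x' y' z' = row3 (x + x') (y + y') (z + z').
Proof. by apply/rowP; apply: forall_I3; rewrite !mxE. Qed.

Lemma row3Z l x y z : l *: row3 x y z = row3 (l * x) (l * y) (l * z).
Proof. by apply/rowP; apply: forall_I3; rewrite !mxE. Qed.

Lemma row3_continuous (T : topologicalType) (x y z : T -> R) : continuous x ->
  continuous y -> continuous z -> continuous (fun t => row3 (x t) (y t) (z t)).
Proof.
move=> cx cy cz; apply: continuous_mx => i; apply: forall_I3.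
- by rewrite (_ : (fun _ => _) = x)//; apply/funext => s; rewrite mxE.
- by rewrite (_ : (fun _ => _) = y)//; apply/funext => s; rewrite mxE.
- by rewrite (_ : (fun _ => _) = z)//; apply/funext => s; rewrite mxE.
Qed.

Lemma derive1_row3 (x y z : R -> R) (t dx dy dz : R) : is_derive t 1 x dx ->
  is_derive t 1 y dy -> is_derive t 1 z dz ->
  derivable (fun s : R => row3 (x s) (y s) (z s)) t 1 /\
  derive1 (fun s : R => row3 (x s) (y s) (z s)) t = row3 dx dy dz.
Proof.
move=> Dx Dy Dz; apply: derive1_mx => i; apply: forall_I3; rewrite !mxE /=.
- by rewrite (_ : (fun _ => _) = x)//; apply/funext => s; rewrite mxE.
- by rewrite (_ : (fun _ => _) = y)//; apply/funext => s; rewrite mxE.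
- by rewrite (_ : (fun _ => _) = z)//; apply/funext => s; rewrite mxE.
Qed.

(** The matrix norm is the largest entry in absolute value, which rotations do not preserve; with
    the Euclidean square the angle drops out of every growth estimate. *)
Definition sqnorm3 (w : 'rV[R]_3) := w ord0 o0 ^+ 2 + w ord0 o1 ^+ 2 + w ord0 o2 ^+ 2.

Lemma sqnorm3_row3 x y z : sqnorm3 (row3 x y z) = x ^+ 2 + y ^+ 2 + z ^+ 2.
Proof. by rewrite /sqnorm3 !mxE. Qed.

Lemma mx_norm_coord m n (A : 'M[R]_(m, n)) i j : `|A i j| <= `|A|.
Proof.
rewrite [leRHS]/Num.Def.normr/= mx_normrE.
exact: (le_bigmax _ (fun ij : 'I_m * 'I_n => `|A ij.1 ij.2|) (i, j)).
Qed.

Lemma sqnorm3_le (w : 'rV[R]_3) : sqnorm3 w <= 3 * `|w| ^+ 2.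
Proof.
have h i : w ord0 i ^+ 2 <= `|w| ^+ 2.
  by rewrite -[leLHS]real_normK ?num_real// lerXn2r ?nnegrE// mx_norm_coord.
by have := h o0; have := h o1; have := h o2; rewrite /sqnorm3; lra.
Qed.

Lemma le_sqnorm3 (w : 'rV[R]_3) : `|w| ^+ 2 <= sqnorm3 w.
Proof.
have s0 : 0 <= sqnorm3 w by rewrite !addr_ge0// sqr_ge0.
rewrite -(sqr_sqrtr s0) lerXn2r ?nnegrE ?sqrtr_ge0//.
rewrite [leLHS]/Num.Def.normr/= mx_normrE bigmax_le ?sqrtr_ge0// => -[i j] _ /=.
rewrite -sqrtr_sqr ler_wsqrtr// (ord1 i) /sqnorm3.
have := sqr_ge0 (w ord0 o0); have := sqr_ge0 (w ord0 o1); have := sqr_ge0 (w ord0 o2).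
by move: j; apply: forall_I3 => ? ? ?; lra.
Qed.

(** The 3 is the cost of bounding the Euclidean norm of [w] by its maximum norm in dimension 3; the
    comparison for [w'] is free. *)
Lemma norm_of_sqnorm3 (w w' : 'rV[R]_3) (C E : R) : 0 <= C -> 0 <= E ->
  sqnorm3 w' <= C * E ^+ 2 * sqnorm3 w -> `|w'| <= Num.sqrt (3 * C) * E * `|w|.
Proof.
move=> C0 E0 h; have K0 := sqrtr_ge0 (3 * C).
rewrite -(@ler_pXn2r _ 2)// ?nnegrE ?mulr_ge0// !exprMn sqr_sqrtr ?mulr_ge0//.
apply: le_trans (le_sqnorm3 _) (le_trans h _).
rewrite (_ : 3 * C * _ * _ = C * E ^+ 2 * (3 * `|w| ^+ 2)); last by ring.
by rewrite ler_wpM2l ?sqnorm3_le// mulr_ge0// sqr_ge0.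
Qed.

End MatrixCalculus.

(** * Recovering an angle from its cosine and sine *)

Section Trigo.
Variable R : realType.

Lemma cos_eq1 (x : R) : cos x = 1 -> exists n : int, x = n%:~R * (2 * pi).
Proof.
have p0 : 0 < 2 * pi :> R by rewrite mulr_gt0// pi_gt0.
have [n [s [-> s0 s2]]] := period_reduce x p0.
have cosT (t : R) : cos (t + 2 * pi) = cos t by rewrite mulr_natl cosD2pi.
rewrite (periodic_int cosT) => cs.
exists n; suff -> : s = 0 by rewrite add0r.
have [sp|sp] := leP s pi.
  by apply: cos_inj; rewrite ?cos0 ?cs// in_itv/= ?lexx ?s0 ?sp ?pi_ge0.
have : 2 * pi - s = 0.
  apply: cos_inj; rewrite ?in_itv/= ?lexx ?pi_ge0//.
    by apply/andP; split; lra.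
  by rewrite cos0 addrC cosT cosN.
by lra.
Qed.

Lemma cos_sin_inj (x y : R) : cos x = cos y -> sin x = sin y ->
  exists n : int, x = y + n%:~R * (2 * pi).
Proof.
move=> cE sE; have [|n nE] := @cos_eq1 (x - y).
  by rewrite cosB cE sE -!expr2 cos2Dsin2.
by exists n; rewrite -nE addrC subrK.
Qed.

Lemma polar_angle (x y : R) : x ^+ 2 + y ^+ 2 = 1 -> exists th, x = cos th /\ y = sin th.
Proof.
move=> xy1.
have x1 : -1 <= x <= 1.
  by have y20 := sqr_ge0 y; apply/andP; split; nra.
have sa : sin (acos x) = `|y|.
  by rewrite sin_acos// -xy1 addrC addKr sqrtr_sqr.
have [y0|y0] := leP 0 y.
  by exists (acos x); rewrite acosK// sa ger0_norm.
by exists (- acos x); rewrite cosN sinN acosK// sa ltr0_norm// opprK.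
Qed.

End Trigo.

(** * The suspended field and its tori *)

Section Suspension.
Variable R : realType.
Variables p pr pz q qr qz : R -> R -> R.
Hypotheses (Cp : planar_C1 p pr pz) (Cq : planar_C1 q qr qz).

(** In cylindrical coordinates with [rho = x^2 + y^2] this reads [rho' = rho p], [z' = rho q], with
    angular speed 1; halving [p] compensates for the square. *)
Definition suspension m (c : 'I_3 -> monom 3 m -> R) := forall x y z : R,
  [/\ peval (c o0) (row3 x y z) = x * p (x ^+ 2 + y ^+ 2) z / 2 - y,
      peval (c o1) (row3 x y z) = y * p (x ^+ 2 + y ^+ 2) z / 2 + x
    & peval (c o2) (row3 x y z) = (x ^+ 2 + y ^+ 2) * q (x ^+ 2 + y ^+ 2) z].

Variables (m : nat) (c : 'I_3 -> monom 3 m -> R).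
Hypothesis (cE : suspension c).

Lemma vf_suspension x y z : vf c (row3 x y z) =
  row3 (x * p (x ^+ 2 + y ^+ 2) z / 2 - y) (y * p (x ^+ 2 + y ^+ 2) z / 2 + x)
       ((x ^+ 2 + y ^+ 2) * q (x ^+ 2 + y ^+ 2) z).
Proof.
have [c0 c1 c2] := cE x y z.
by apply/rowP; apply: forall_I3; rewrite !mxE.
Qed.

Lemma Jac_suspension x y z u v w (rho := x ^+ 2 + y ^+ 2) (s := 2 * (x * u + y * v)) :
  Jac c (row3 x y z) *m (row3 u v w)^T =
  (row3 (u * p rho z / 2 + x * (pr rho z * s + pz rho z * w) / 2 - v)
        (v * p rho z / 2 + y * (pr rho z * s + pz rho z * w) / 2 + u)
        (s * q rho z + rho * (qr rho z * s + qz rho z * w)))^T.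
Proof.
have lin (a b : R) : is_derive (0 : R) 1 (fun t : R => a + t * b) b.
  apply: is_derive1_eq (is_derive1D (is_derive1_cst _ a) (is_derive1M (is_derive_id _ _) (is_derive1_cst _ b))) _.
  by rewrite mul1r mulr0 addr0 add0r.
have Dx := lin x u; have Dy := lin y v; have Dz := lin z w.
have Dr : is_derive (0 : R) 1 (fun t : R => (x + t * u) ^+ 2 + (y + t * v) ^+ 2) s.
  by apply: is_derive1_eq (is_derive1D (is_derive1X 2 Dx) (is_derive1X 2 Dy)) _; rewrite /s /=; ring.
have r0 : (x + 0 * u) ^+ 2 + (y + 0 * v) ^+ 2 = rho by rewrite !mul0r !addr0.
have z0 : z + 0 * w = z by rewrite mul0r addr0.
have Dp : is_derive (0 : R) 1 (fun t : R => p ((x + t * u) ^+ 2 + (y + t * v) ^+ 2) (z + t * w))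
    (pr rho z * s + pz rho z * w).
  by have [+ _ _] := Cp => /(_ _ _ _ _ _ Dr Dz); rewrite r0 z0.
have Dq : is_derive (0 : R) 1 (fun t : R => q ((x + t * u) ^+ 2 + (y + t * v) ^+ 2) (z + t * w))
    (qr rho z * s + qz rho z * w).
  by have [+ _ _] := Cq => /(_ _ _ _ _ _ Dr Dz); rewrite r0 z0.
apply/colP => i; apply: is_derive1_unique (Jac_direction c _ _ i) _.
have -> : (fun t : R => peval (c i) (row3 x y z + t *: (row3 u v w)^T^T)) =
    (fun t : R => peval (c i) (row3 (x + t * u) (y + t * v) (z + t * w))).
  by apply/funext => t; rewrite trmxK row3Z row3D.
move: i; apply: forall_I3; rewrite !mxE /=.
- have -> : (fun t : R => peval (c o0) (row3 (x + t * u) (y + t * v) (z + t * w))) =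
    (fun t : R => (x + t * u) * p ((x + t * u) ^+ 2 + (y + t * v) ^+ 2) (z + t * w) * 2^-1 - (y + t * v)).
    by apply/funext => t; have [-> _ _] := cE (x + t * u) (y + t * v) (z + t * w).
  apply: is_derive1_eq (is_derive1B (is_derive1M (is_derive1M Dx Dp) (is_derive1_cst _ _)) Dy) _.
  by rewrite r0 z0; ring.
- have -> : (fun t : R => peval (c o1) (row3 (x + t * u) (y + t * v) (z + t * w))) =
    (fun t : R => (y + t * v) * p ((x + t * u) ^+ 2 + (y + t * v) ^+ 2) (z + t * w) * 2^-1 + (x + t * u)).
    by apply/funext => t; have [_ -> _] := cE (x + t * u) (y + t * v) (z + t * w).
  apply: is_derive1_eq (is_derive1D (is_derive1M (is_derive1M Dy Dp) (is_derive1_cst _ _)) Dx) _.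
  by rewrite r0 z0; ring.
- have -> : (fun t : R => peval (c o2) (row3 (x + t * u) (y + t * v) (z + t * w))) =
    (fun t : R => ((x + t * u) ^+ 2 + (y + t * v) ^+ 2) * q ((x + t * u) ^+ 2 + (y + t * v) ^+ 2) (z + t * w)).
    by apply/funext => t; have [_ _ ->] := cE (x + t * u) (y + t * v) (z + t * w).
  apply: is_derive1_eq (is_derive1M Dr Dq) _.
  by rewrite r0 z0; ring.
Qed.

Variables (a z b d : R -> R) (T mu : R).
Hypothesis H : lifted_cycle p pr pz q qr qz a z b d T mu.

Definition da t := a t * p (a t ^+ 2) (z t) / 2.
Definition dz t := a t ^+ 2 * q (a t ^+ 2) (z t).

Definition torus_pt t th := row3 (a t * cos th) (a t * sin th) (z t).
(* A frame along the torus: the meridian part of the field, the rotation field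
   and the transverse Floquet solution. *)
Definition frame1 t th := row3 (da t * cos th) (da t * sin th) (dz t).
Definition frame2 t th := row3 (- (a t * sin th)) (a t * cos th) 0.
Definition frame3 t th := row3 (b t * cos th) (b t * sin th) (d t).

Lemma is_derive_cosD (th t : R) : is_derive t 1 (fun s : R => cos (th + s)) (- sin (th + t)).
Proof.
have h : is_derive t 1 (fun s : R => th + s) 1.
  by apply: is_derive1_eq (is_derive1D (is_derive1_cst _ _) (is_derive_id _ _)) (add0r _).
by apply: is_derive1_eq (is_derive1_comp (is_derive_cos (th + t)) h) (mulr1 _).
Qed.

Lemma is_derive_sinD (th t : R) : is_derive t 1 (fun s : R => sin (th + s)) (cos (th + t)).
Proof.
have h : is_derive t 1 (fun s : R => th + s) 1.
  by apply: is_derive1_eq (is_derive1D (is_derive1_cst _ _) (is_derive_id _ _)) (add0r _).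
by apply: is_derive1_eq (is_derive1_comp (is_derive_sin (th + t)) h) (mulr1 _).
Qed.

Lemma is_derive1_shiftl (f : R -> R) (s t l : R) : is_derive (s + t) 1 f l ->
  is_derive t 1 (fun x : R => f (s + x)) l.
Proof.
rewrite addrC => h; rewrite (_ : (fun x => _) = (fun x : R => f (x + s))).
  exact: is_derive1_shift.
by apply/funext => x; rewrite addrC.
Qed.

Lemma polar_sqr (k th : R) : (k * cos th) ^+ 2 + (k * sin th) ^+ 2 = k ^+ 2.
Proof. by rewrite !exprMn -mulrDr cos2Dsin2 mulr1. Qed.

Lemma d_a (t : R) : is_derive t 1 a (da t). Proof. by have [[_ _ _ /(_ t)[[]]]] := H. Qed.
Lemma d_z (t : R) : is_derive t 1 z (dz t). Proof. by have [[_ _ _ /(_ t)[[]]]] := H. Qed.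
Lemma a_gt0 t : 0 < a t. Proof. by have [[_ _ _ /(_ t)[[]]]] := H. Qed.
Lemma T_gt0 : 0 < T. Proof. by have [[]] := H. Qed.
Lemma aT t : a (t + T) = a t. Proof. by have [[_ _ _ /(_ t)[_ _ _ []]]] := H. Qed.
Lemma zT t : z (t + T) = z t. Proof. by have [[_ _ _ /(_ t)[_ _ _ []]]] := H. Qed.
Lemma bT t : b (t + T) = mu * b t. Proof. by have [[_ _ _ /(_ t)[_ _ _ []]]] := H. Qed.
Lemma dT t : d (t + T) = mu * d t. Proof. by have [[_ _ _ /(_ t)[_ _ _ []]]] := H. Qed.
Lemma daT t : da (t + T) = da t. Proof. by rewrite /da aT zT. Qed.
Lemma dzT t : dz (t + T) = dz t. Proof. by rewrite /dz aT zT. Qed.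
Lemma transverse t : b t * dz t - d t * da t != 0.
Proof. by have [[_ _ _ /(_ t)[]]] := H. Qed.

Lemma a_cont : continuous a. Proof. by move=> t; exact: is_derive1_continuous (d_a t). Qed.
Lemma z_cont : continuous z. Proof. by move=> t; exact: is_derive1_continuous (d_z t). Qed.

Lemma da_dz_cont : continuous da /\ continuous dz.
Proof.
have a2 := continuous_expn (n := 2) a_cont.
have [_ /(_ _ _ _ a2 z_cont)[cp _ _] _] := Cp.
have [_ /(_ _ _ _ a2 z_cont)[cq _ _] _] := Cq.
split=> t; apply: cvgM; [|exact: cvg_cst|exact: a2|exact: cq].
by apply: cvgM; [exact: a_cont|exact: cp].
Qed.

Lemma torus_sol (s th : R) : is_sol c (fun t => torus_pt (s + t) (th + t)).
Proof.
move=> t; have [h e] := derive1_row3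
  (is_derive1M (is_derive1_shiftl (d_a (s + t))) (is_derive_cosD th t))
  (is_derive1M (is_derive1_shiftl (d_a (s + t))) (is_derive_sinD th t))
  (is_derive1_shiftl (d_z (s + t))).
split; first exact: h.
rewrite [LHS]e vf_suspension polar_sqr /da /dz.
by congr row3; ring.
Qed.

Definition is_var (x w : R -> 'rV[R]_3) := forall t,
  derivable w t 1 /\ derive1 w t = (Jac c (x t) *m (w t)^T)^T.

(** A variation with radial part [u], axial part [v] and no angular part keeps this form, because
    the field is rotation invariant with constant angular speed; the variational equation thus
    reduces to that of the half-plane system in [(a, z)]. *)
Lemma polar_var (u v du dv : R -> R) (s th : R) :
  (forall t : R, is_derive t 1 u (du t)) -> (forall t : R, is_derive t 1 v (dv t)) ->
  (forall t, du t = u t * p (a t ^+ 2) (z t) / 2 + a t *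
          (pr (a t ^+ 2) (z t) * (2 * a t * u t) + pz (a t ^+ 2) (z t) * v t) / 2) ->
  (forall t, dv t = 2 * a t * u t * q (a t ^+ 2) (z t) + a t ^+ 2 *
          (qr (a t ^+ 2) (z t) * (2 * a t * u t) + qz (a t ^+ 2) (z t) * v t)) ->
  is_var (fun t => torus_pt (s + t) (th + t))
    (fun t => row3 (u (s + t) * cos (th + t)) (u (s + t) * sin (th + t)) (v (s + t))).
Proof.
move=> Du Dv duE dvE t; have [h e] := derive1_row3
  (is_derive1M (is_derive1_shiftl (Du (s + t))) (is_derive_cosD th t))
  (is_derive1M (is_derive1_shiftl (Du (s + t))) (is_derive_sinD th t))
  (is_derive1_shiftl (Dv (s + t))).
split; first exact: h.
rewrite [LHS]e Jac_suspension trmxK polar_sqr.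
have -> : 2 * (a (s + t) * cos (th + t) * (u (s + t) * cos (th + t)) +
   a (s + t) * sin (th + t) * (u (s + t) * sin (th + t))) = 2 * a (s + t) * u (s + t).
  transitivity (2 * a (s + t) * u (s + t) * (cos (th + t) ^+ 2 + sin (th + t) ^+ 2)); first by ring.
  by rewrite cos2Dsin2 mulr1.
by rewrite duE dvE; congr row3; ring.
Qed.

(** The velocity of the half-plane orbit solves the half-plane variational equation. The full field
    on the torus is [frame1 + frame2], so this is what remains once the rotation is split off. *)
Lemma frame1_var s th : is_var (fun t => torus_pt (s + t) (th + t)) (fun t => frame1 (s + t) (th + t)).
Proof.
have Dp (t : R) : is_derive t 1 (fun s : R => p (a s ^+ 2) (z s))
    (pr (a t ^+ 2) (z t) * (2 * a t * da t) + pz (a t ^+ 2) (z t) * dz t).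
  by have [+ _ _] := Cp => /(_ _ _ _ _ _ (is_derive1X 2 (d_a t)) (d_z t)); rewrite expr1.
have Dq (t : R) : is_derive t 1 (fun s : R => q (a s ^+ 2) (z s))
    (qr (a t ^+ 2) (z t) * (2 * a t * da t) + qz (a t ^+ 2) (z t) * dz t).
  by have [+ _ _] := Cq => /(_ _ _ _ _ _ (is_derive1X 2 (d_a t)) (d_z t)); rewrite expr1.
apply: (polar_var (u := da) (v := dz)).
- by move=> t; exact: (is_derive1M (is_derive1M (d_a t) (Dp t)) (is_derive1_cst t 2^-1)).
- by move=> t; exact: (is_derive1M (is_derive1X 2 (d_a t)) (Dq t)).
- by move=> t /=; ring.
- by move=> t /=; ring.
Qed.

Lemma frame3_var s th : is_var (fun t => torus_pt (s + t) (th + t)) (fun t => frame3 (s + t) (th + t)).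
Proof.
by apply: (polar_var (u := b) (v := d)) => // t; have [[_ _ _ /(_ t)[]]] := H.
Qed.

(** Rotations about the axis map solutions to solutions, so the derivative in the angle solves the
    variational equation. *)
Lemma frame2_var s th : is_var (fun t => torus_pt (s + t) (th + t)) (fun t => frame2 (s + t) (th + t)).
Proof.
move=> t; have [h e] := derive1_row3
  (is_derive1N (is_derive1M (is_derive1_shiftl (d_a (s + t))) (is_derive_sinD th t)))
  (is_derive1M (is_derive1_shiftl (d_a (s + t))) (is_derive_cosD th t))
  (is_derive1_cst t 0).
split; first exact: h.
rewrite [LHS]e Jac_suspension trmxK polar_sqr /da.
by congr row3; ring.
Qed.

Definition frame t th : 'M[R]_3 :=
  \matrix_(i < 3) nth 0 [:: frame1 t th; frame2 t th; frame3 t th] i.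

Lemma row_frame t th :
  [/\ row o0 (frame t th) = frame1 t th, row o1 (frame t th) = frame2 t th
    & row o2 (frame t th) = frame3 t th].
Proof. by split; apply/rowP => j; rewrite !mxE. Qed.

Lemma frame_unit t th : frame t th \in unitmx.
Proof.
rewrite -row_free_unit -kermx_eq0; apply/rowV0P => v /sub_kermxP.
have [f1 f2 f3] := row_frame t th.
rewrite mulmx_sum_row => e.
have {e} : v ord0 o0 *: frame1 t th + v ord0 o1 *: frame2 t th + v ord0 o2 *: frame3 t th = 0.
  rewrite -e -f1 -f2 -f3; apply/rowP => j; rewrite !mxE summxE sum3 !mxE.
  by [].
have -> : (0 : 'rV[R]_3) = row3 0 0 0 by apply/rowP; apply: forall_I3; rewrite !mxE.
rewrite !row3Z !row3D; set al := v _ o0; set be := v _ o1; set ga := v _ o2.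
move=> /row3_inj[e1 e2 e3].
have a0 : a t != 0 by rewrite gt_eqF// a_gt0.
(* The angular component at angle [th] isolates [be]. The radial and axial ones form a linear system
   in [al] and [ga] whose determinant is, up to sign, the quantity of [transverse]. *)
have be0 : be = 0.
  apply/eqP; rewrite -(mulIr_eq0 _ (mulIf a0)).
  have : - sin th * 0 + cos th * 0 = be * a t * (cos th ^+ 2 + sin th ^+ 2).
    by rewrite -{1}e1 -e2; ring.
  by rewrite cos2Dsin2 mulr1 !mulr0 addr0 => <-.
have k : al * da t + ga * b t = 0.
  have : cos th * 0 + sin th * 0 = (al * da t + ga * b t) * (cos th ^+ 2 + sin th ^+ 2).
    by rewrite -{1}e1 -e2; ring.
  by rewrite cos2Dsin2 mulr1 !mulr0 addr0 => <-.
have e3' : al * dz t + ga * d t = 0 by rewrite -e3; ring.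
have ga0 : ga = 0.
  apply/eqP; rewrite -(mulIr_eq0 _ (mulIf (transverse t))).
  have -> : ga * (b t * dz t - d t * da t) =
    dz t * (al * da t + ga * b t) - da t * (al * dz t + ga * d t) by ring.
  by rewrite k e3' !mulr0 subrr.
have al0 : al = 0.
  apply/eqP; rewrite -(mulIr_eq0 _ (mulIf (transverse t))).
  have -> : al * (b t * dz t - d t * da t) =
    b t * (al * dz t + ga * d t) - d t * (al * da t + ga * b t) by ring.
  by rewrite k e3' !mulr0 subrr.
by apply/rowP; apply: forall_I3; rewrite [RHS]mxE.
Qed.

(** The linear map carrying the initial frame to the frame at time [t], transposed because frame
    vectors are rows while a fundamental matrix acts on columns. It solves the variational equation
    as a recombination of three solutions with constant coefficients. *)
Definition transition s th t : 'M[R]_3 := (invmx (frame s th) *m frame (s + t) (th + t))^T.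

Lemma transition_fundamental s th :
  is_fundamental c (fun t => torus_pt (s + t) (th + t)) (transition s th).
Proof.
split; first by rewrite /transition !addr0 mulVmx ?frame_unit// trmx1.
move=> t; set V := invmx (frame s th).
have Dw i : derivable (fun t => row i (frame (s + t) (th + t))) t 1 /\
   derive1 (fun t => row i (frame (s + t) (th + t))) t =
     (Jac c (torus_pt (s + t) (th + t)) *m (row i (frame (s + t) (th + t)))^T)^T.
  move: i; apply: forall_I3.
  - rewrite (_ : (fun t => _) = (fun t => frame1 (s + t) (th + t))); last first.
      by apply/funext => x; have [] := row_frame (s + x) (th + x).
    by have [-> _ _] := row_frame (s + t) (th + t); exact: frame1_var.
  - rewrite (_ : (fun t => _) = (fun t => frame2 (s + t) (th + t))); last first.
      by apply/funext => x; have [] := row_frame (s + x) (th + x).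
    by have [_ -> _] := row_frame (s + t) (th + t); exact: frame2_var.
  - rewrite (_ : (fun t => _) = (fun t => frame3 (s + t) (th + t))); last first.
      by apply/funext => x; have [] := row_frame (s + x) (th + x).
    by have [_ _ ->] := row_frame (s + t) (th + t); exact: frame3_var.
apply: derive1_mx => i j.
rewrite (_ : (fun x => _) = (fun x : R => \sum_k V j k * (row k (frame (s + x) (th + x))) ord0 i)).
  have := is_derive1_sum (index_enum 'I_3) xpredT
    (fun k => is_derive1Z (V j k) (is_derive1_mx ord0 i (Dw k).1)).
  move=> h; apply: is_derive1_eq h _.
  rewrite /transition mxE.
  under eq_bigr do rewrite (Dw _).2 !mxE mulr_sumr.
  rewrite exchange_big/=; apply: eq_bigr => l _.
  rewrite !mxE mulr_sumr; apply: eq_bigr => k _; rewrite !mxE; ring.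
apply/funext => x; rewrite /transition !mxE; apply: eq_bigr => k _.
by rewrite [row _ _ _ _]mxE.
Qed.

Lemma transition_frame s th t :
  [/\ frame1 s th *m (transition s th t)^T = frame1 (s + t) (th + t),
      frame2 s th *m (transition s th t)^T = frame2 (s + t) (th + t)
    & frame3 s th *m (transition s th t)^T = frame3 (s + t) (th + t)].
Proof.
have [f1 f2 f3] := row_frame s th; have [g1 g2 g3] := row_frame (s + t) (th + t).
rewrite /transition trmxK -f1 -f2 -f3 -g1 -g2 -g3 !mulmxA.
have h i : row i (frame s th) *m invmx (frame s th) *m frame (s + t) (th + t) =
    row i (frame (s + t) (th + t)).
  by rewrite -row_mul mulmxV ?frame_unit// row1 -rowE.
by rewrite !h.
Qed.


(** * Effect of whole periods on the torus and its frame *)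

Lemma frame3_int (n : int) : exists2 k, k != 0 & forall t, b (t + n%:~R * T) = k * b t /\
  d (t + n%:~R * T) = k * d t.
Proof.
have mu0 : mu != 0 by have [[]] := H.
have nat (j : nat) : exists2 k, k != 0 & forall t, b (t + j%:R * T) = k * b t /\
    d (t + j%:R * T) = k * d t.
  elim: j => [|j [k k0 ih]].
    by exists 1; [exact: oner_neq0|move=> t; rewrite mul0r addr0 !mul1r].
  exists (mu * k); first by rewrite mulf_neq0.
  move=> t; have [ib id] := ih t.
  by rewrite mulrSr mulrDl mul1r addrA bT dT ib id !mulrA.
case: n => n; first exact: nat.
have [k k0 kE] := nat n.+1; exists k^-1; first exact: invr_neq0.
move=> t; rewrite NegzE mulrNz mulNr -[n.+1%:~R]/(n.+1%:R).
have [-> ->] : b t = k * b (t - n.+1%:R * T) /\ d t = k * d (t - n.+1%:R * T).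
  by have [<- <-] := kE (t - n.+1%:R * T); rewrite !subrK.
by split; rewrite mulKf.
Qed.

Let cos2piT (t : R) : cos (t + 2 * pi) = cos t. Proof. by rewrite mulr_natl cosD2pi. Qed.
Let sin2piT (t : R) : sin (t + 2 * pi) = sin t. Proof. by rewrite mulr_natl sinD2pi. Qed.

Lemma torus_pt_inj t th t' th' : torus_pt t th = torus_pt t' th' ->
  (exists n : int, t = t' + n%:~R * T) /\ (exists n : int, th = th' + n%:~R * (2 * pi)).
Proof.
move=> /row3_inj[e1 e2 e3].
have aE : a t = a t'.
  apply/eqP; rewrite -(@eqrXn2 _ 2)//; try exact/ltW/a_gt0.
  by rewrite -(polar_sqr (a t) th) -(polar_sqr (a t') th') e1 e2.
have an0 : a t' != 0 by rewrite gt_eqF// a_gt0.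
have [_ inj] := H; split; first exact: inj.
by apply: cos_sin_inj; apply: (mulfI an0); [rewrite -e1|rewrite -e2]; rewrite aE.
Qed.

Lemma torus_ptDint (n k : int) t th :
  torus_pt (t + n%:~R * T) (th + k%:~R * (2 * pi)) = torus_pt t th.
Proof.
by rewrite /torus_pt (periodic_int aT) (periodic_int zT) (periodic_int cos2piT) (periodic_int sin2piT).
Qed.

Lemma frame12Dint (n k : int) t th :
  frame1 (t + n%:~R * T) (th + k%:~R * (2 * pi)) = frame1 t th /\
  frame2 (t + n%:~R * T) (th + k%:~R * (2 * pi)) = frame2 t th.
Proof.
by rewrite /frame1 /frame2 (periodic_int daT) (periodic_int dzT) (periodic_int aT)
  (periodic_int cos2piT) (periodic_int sin2piT).
Qed.

(** Periods rescale [frame3], so only its line is a function of the point of the torus; [<<_>>]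
    selects one matrix per line and turns this into an equality. *)
Lemma frame3Dint (n k : int) t th :
  (<<frame3 (t + n%:~R * T) (th + k%:~R * (2 * pi))>> = <<frame3 t th>>)%MS.
Proof.
have [l l0 lE] := frame3_int n; have [bE dE] := lE t.
apply: eq_genmx; rewrite /frame3 (periodic_int cos2piT) (periodic_int sin2piT) bE dE.
by rewrite -!mulrA -row3Z; exact: eqmx_scale.
Qed.

(** * The embedding with unit periods and its tangent planes *)

Definition torus u v := torus_pt (T * u) (2 * pi * v).

Lemma is_derive1_mulr (f : R -> R) (k t l : R) : is_derive (k * t) 1 f l ->
  is_derive t 1 (fun s : R => f (k * s)) (k * l).
Proof.
move=> h; have hk : is_derive t 1 (fun s : R => k * s) k.
  by apply: is_derive1_eq (is_derive1Z k (is_derive_id t 1)) (mulr1 _).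
by apply: is_derive1_eq (is_derive1_comp h hk) (mulrC _ _).
Qed.

Lemma torus_du u v : derivable (fun s => torus s v) u 1 /\
  du torus u v = T *: frame1 (T * u) (2 * pi * v).
Proof.
have [h e] := derive1_row3
  (is_derive1M (is_derive1_mulr (d_a (T * u))) (is_derive1_cst u (cos (2 * pi * v))))
  (is_derive1M (is_derive1_mulr (d_a (T * u))) (is_derive1_cst u (sin (2 * pi * v))))
  (is_derive1_mulr (d_z (T * u))).
split; first exact: h.
by rewrite [LHS]e /frame1 row3Z; congr row3; ring.
Qed.

Lemma torus_dv u v : derivable (fun s => torus u s) v 1 /\
  dv torus u v = (2 * pi) *: frame2 (T * u) (2 * pi * v).
Proof.
have [h e] := derive1_row3
  (is_derive1Z (a (T * u)) (is_derive1_mulr (is_derive_cos (2 * pi * v))))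
  (is_derive1Z (a (T * u)) (is_derive1_mulr (is_derive_sin (2 * pi * v))))
  (is_derive1_cst v (z (T * u))).
split; first exact: h.
by rewrite [LHS]e /frame2 row3Z; congr row3; ring.
Qed.

Let pi2_neq0 : 2 * pi != 0 :> R.
Proof. by rewrite mulf_neq0// gt_eqF// pi_gt0. Qed.

Let T_neq0 : T != 0.
Proof. by rewrite gt_eqF// T_gt0. Qed.

Lemma tangentE u v :
  (tangent torus u v :=: frame1 (T * u) (2 * pi * v) + frame2 (T * u) (2 * pi * v))%MS.
Proof.
rewrite /tangent (torus_du u v).2 (torus_dv u v).2.
apply: eqmx_trans (eqmx_sym (addsmxE _ _)) _.
by apply: adds_eqmx; apply: eqmx_scale.
Qed.

(** Three vectors spanning a space of dimension 3 leave no slack in the rank inequalities. *)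
Lemma frame_ranks t th : [/\ (1%:M <= frame1 t th + frame2 t th + frame3 t th)%MS,
  \rank (frame1 t th + frame2 t th) = 2 & \rank (frame3 t th) = 1].
Proof.
have [f1 f2 f3] := row_frame t th.
have full : (1%:M <= frame1 t th + frame2 t th + frame3 t th)%MS.
  have W1 : (1%:M <= frame t th)%MS by rewrite sub1mx row_full_unit frame_unit.
  apply: submx_trans W1 _; apply/row_subP; apply: forall_I3.
  - by rewrite f1 (submx_trans (addsmxSl _ (frame2 t th))) ?addsmxSl.
  - by rewrite f2 (submx_trans (addsmxSr (frame1 t th) _)) ?addsmxSl.
  - by rewrite f3 addsmxSr.
have r3 : (3 <= \rank (frame1 t th + frame2 t th + frame3 t th))%N.
  by have := mxrankS full; rewrite mxrank1.
have r12 := mxrank_adds_leqif (frame1 t th + frame2 t th)%MS (frame3 t th).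
have r1_2 := mxrank_adds_leqif (frame1 t th) (frame2 t th).
have h1 := rank_leq_row (frame1 t th); have h2 := rank_leq_row (frame2 t th).
have h3 := rank_leq_row (frame3 t th).
have k1 := leq_trans r3 r12.1; have k2 : (_ <= _)%N := r1_2.1.
by split => //; lia.
Qed.

Lemma torus_embedding_torus : torus_embedding torus.
Proof.
have [cda cdz] := da_dz_cont.
have cT (f : R -> R) : continuous f -> continuous (fun x : R * R => f (T * x.1)).
  move=> cf x; apply: (@continuous_comp _ _ _ (fun x : R * R => T * x.1) f); last exact: cf.
  by apply: cvgM; [exact: cvg_cst|exact: cvg_fst].
have cP (f : R -> R) : continuous f -> continuous (fun x : R * R => f (2 * pi * x.2)).
  move=> cf x; apply: (@continuous_comp _ _ _ (fun x : R * R => 2 * pi * x.2) f); last exact: cf.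
  by apply: cvgM; [exact: cvg_cst|exact: cvg_snd].
have cM (f g : R * R -> R) : continuous f -> continuous g -> continuous (fun x => f x * g x).
  by move=> cf cg x; apply: cvgM; [exact: cf|exact: cg].
split; first split.
- move=> u v; rewrite /torus.
  have -> : T * (u + 1) = T * u + 1%:~R * T by rewrite mul1r; ring.
  have -> : 2 * pi * (v + 1) = 2 * pi * v + 1%:~R * (2 * pi) by rewrite mul1r; ring.
  have := torus_ptDint 1 0 (T * u) (2 * pi * v); rewrite mulr0z mul0r addr0 => ->.
  by have := torus_ptDint 0 1 (T * u) (2 * pi * v); rewrite mulr0z mul0r addr0 => ->.
- move=> u v u' v' /torus_pt_inj[[n nE] [k kE]].
  have -> : u - u' = n%:~R by apply: (mulfI T_neq0); rewrite mulrBr nE addrC addKr mulrC.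
  have -> : v - v' = k%:~R by apply: (mulfI pi2_neq0); rewrite mulrBr kE addrC addKr mulrC.
  by rewrite !intr_int.
- by move=> u v; split; [exact: (torus_du u v).1|exact: (torus_dv u v).1].
- rewrite (_ : (fun _ => _) = (fun x : R * R => row3 (T * (da (T * x.1) * cos (2 * pi * x.2)))
      (T * (da (T * x.1) * sin (2 * pi * x.2))) (T * dz (T * x.1)))); last first.
    by apply/funext => x; rewrite (torus_du x.1 x.2).2 row3Z.
  have cc := cP _ (@continuous_cos R); have cs := cP _ (@continuous_sin R).
  have cTc : continuous (fun _ : R * R => T) by move=> x; exact: cvg_cst.
  by apply: row3_continuous; apply: (cM _ _ cTc); [apply: cM => //; exact: cT|apply: cM => //; exact: cT|exact: cT].
- rewrite (_ : (fun _ => _) = (fun x : R * R => row3 ((2 * pi) * ((- a (T * x.1)) * sin (2 * pi * x.2)))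
      ((2 * pi) * (a (T * x.1) * cos (2 * pi * x.2))) 0)); last first.
    by apply/funext => x; rewrite (torus_dv x.1 x.2).2 row3Z mulr0 mulNr.
  have cc := cP _ (@continuous_cos R); have cs := cP _ (@continuous_sin R).
  have c2 : continuous (fun _ : R * R => 2 * pi : R) by move=> x; exact: cvg_cst.
  apply: row3_continuous; last by move=> x; exact: cvg_cst.
    apply: (cM _ _ c2); apply: cM => //; apply: (cT (fun x => - a x)) => t.
    by apply: cvgN; exact: a_cont.
  by apply: (cM _ _ c2); apply: cM => //; apply: cT; exact: a_cont.
- move=> u v; rewrite -[col_mx _ _]/(tangent torus u v) /row_free tangentE.
  by have [_ -> _] := frame_ranks (T * u) (2 * pi * v).
Qed.

(** * Growth of the frame under the linearized flow *)

Lemma sqnorm_frame12 al be t th : sqnorm3 (al *: frame1 t th + be *: frame2 t th) =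
  al ^+ 2 * (da t ^+ 2 + dz t ^+ 2) + be ^+ 2 * a t ^+ 2.
Proof.
rewrite !row3Z row3D sqnorm3_row3.
transitivity (al ^+ 2 * (da t ^+ 2 * (cos th ^+ 2 + sin th ^+ 2) + dz t ^+ 2) +
  be ^+ 2 * a t ^+ 2 * (cos th ^+ 2 + sin th ^+ 2)); first by ring.
by rewrite cos2Dsin2 !mulr1.
Qed.

Lemma sqnorm_frame3 k t th : sqnorm3 (k *: frame3 t th) = k ^+ 2 * (b t ^+ 2 + d t ^+ 2).
Proof.
rewrite !row3Z sqnorm3_row3.
transitivity (k ^+ 2 * (b t ^+ 2 * (cos th ^+ 2 + sin th ^+ 2) + d t ^+ 2)); first by ring.
by rewrite cos2Dsin2 !mulr1.
Qed.

Lemma periodic_ratio (f : R -> R) : continuous f -> (forall t, f (t + T) = f t) ->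
  (forall t, 0 < f t) -> exists2 C : R, 0 <= C & forall s t, f s <= C * f t.
Proof.
move=> cf fT f0; have [B fB] := periodic_bounded T_gt0 cf fT.
have [l l0 fl] := periodic_lower_bound T_gt0 cf fT f0.
have B0 : 0 <= B by apply: le_trans (fB 0).
exists (B / l); first by rewrite divr_ge0// ltW.
move=> s t; apply: le_trans (ler_norm _) (le_trans (fB s) _).
by rewrite mulrAC ler_pdivlMr// ler_wpM2l.
Qed.

(** The real part of the Floquet exponent, negative exactly when [|mu| < 1]. *)
Definition rate := ln `|mu| / T.

Lemma rate_neq0 : rate != 0.
Proof.
have [[_ mu0 mu1 _] _] := H.
rewrite mulf_neq0 ?invr_neq0// ln_eq0 ?normr_gt0//.
Qed.

(** Floquet normal form: over a period both the squared length and [expR (rate * t) ^+ 2] are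
    multiplied by [mu ^+ 2], so their quotient is periodic and positive, and its values are
    comparable. *)
Lemma frame3_growth : exists2 C : R, 0 <= C & forall s t,
  b (s + t) ^+ 2 + d (s + t) ^+ 2 <= C * expR (rate * t) ^+ 2 * (b s ^+ 2 + d s ^+ 2).
Proof.
have [[_ mu0 mu1 _] _] := H.
pose S (t : R) : R := b t ^+ 2 + d t ^+ 2.
pose f (t : R) : R := S t * expR (- (rate * t)) ^+ 2.
have cb : continuous b by move=> t; have [[_ _ _ /(_ t)[_ /is_derive1_continuous]]] := H.
have cd : continuous d by move=> t; have [[_ _ _ /(_ t)[_ _ /is_derive1_continuous]]] := H.
have S0 t : 0 < S t.
  rewrite lt0r addr_ge0 ?sqr_ge0// andbT; apply: contraNneq (transverse t).
  move=> /eqP; rewrite paddr_eq0 ?sqr_ge0// !sqrf_eq0 => /andP[/eqP-> /eqP->].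
  by rewrite !mul0r subrr.
have ce : continuous (fun t : R => expR (- (rate * t))).
  move=> t; apply: (@continuous_comp _ _ _ (fun t : R => - (rate * t)) expR); last exact: continuous_expR.
  by apply: cvgN; apply: cvgM; [exact: cvg_cst|exact: cvg_id].
have [|||C C0 hC] := @periodic_ratio f.
- move=> t; apply: cvgM; last exact: (continuous_expn (n := 2) ce).
  by apply: cvgD; [exact: (continuous_expn (n := 2) cb)|exact: (continuous_expn (n := 2) cd)].
- move=> t; rewrite /f /S bT dT !exprMn -mulrDr.
  have -> : expR (- (rate * (t + T))) = expR (- (rate * t)) / `|mu|.
    rewrite mulrDr opprD exp.expRD; congr (_ * _).
    by rewrite /rate divfK// expRN lnK// posrE normr_gt0.
  rewrite exprMn exprVn real_normK ?num_real//; field.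
  by rewrite mu0.
- by move=> t; rewrite mulr_gt0// exprn_gt0// expR_gt0.
exists C => // s t; have := hC (s + t) s; rewrite /f -/(S (s + t)) -/(S s).
rewrite mulrDr opprD exp.expRD; set x := expR (- (rate * s)).
have x0 : 0 < x := expR_gt0 _.
have yE : expR (- (rate * t)) * expR (rate * t) = 1 by rewrite -exp.expRD addNr exp.expR0.
have y0 : 0 < expR (- (rate * t)) by exact: expR_gt0.
move=> h; rewrite -(ler_pM2r (_ : 0 < (x * expR (- (rate * t))) ^+ 2)); last first.
  by rewrite exprn_gt0// mulr_gt0.
apply: le_trans h _.
rewrite (_ : C * _ * _ * _ = C * (S s * x ^+ 2) * (expR (- (rate * t)) * expR (rate * t)) ^+ 2).
  by rewrite yE expr1n mulr1.
by ring.
Qed.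

(** Since [frame1] and [frame2] are orthogonal and their coefficients are constant along the flow,
    the squared length of a tangent vector is a combination of two positive periodic functions, each
    comparable with itself at any other time. *)
Lemma frame12_growth : exists2 C : R, 0 <= C & forall s t (al be : R),
  al ^+ 2 * (da (s + t) ^+ 2 + dz (s + t) ^+ 2) + be ^+ 2 * a (s + t) ^+ 2 <=
  C * (al ^+ 2 * (da s ^+ 2 + dz s ^+ 2) + be ^+ 2 * a s ^+ 2).
Proof.
have [cda cdz] := da_dz_cont.
have [|||C1 C10 h1] := @periodic_ratio (fun t => da t ^+ 2 + dz t ^+ 2).
- by move=> t; apply: cvgD; [exact: (continuous_expn (n := 2) cda)|exact: (continuous_expn (n := 2) cdz)].
- by move=> t; rewrite daT dzT.
- move=> t; rewrite lt0r addr_ge0 ?sqr_ge0// andbT; apply: contraNneq (transverse t).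
  move=> /eqP; rewrite paddr_eq0 ?sqr_ge0// !sqrf_eq0 => /andP[/eqP-> /eqP->].
  by rewrite !mulr0 subrr.
have [|||C2 C20 h2] := @periodic_ratio (fun t => a t ^+ 2).
- exact: (continuous_expn (n := 2) a_cont).
- by move=> t; rewrite aT.
- by move=> t; rewrite exprn_gt0// a_gt0.
exists (C1 + C2); first exact: addr_ge0.
move=> s t al be; rewrite [leRHS]mulrDr; apply: lerD.
  rewrite mulrCA ler_wpM2l ?sqr_ge0// (le_trans (h1 _ s))// ler_wpM2r ?lerDl//.
  by rewrite addr_ge0// sqr_ge0.
by rewrite [leRHS]mulrCA ler_wpM2l ?sqr_ge0// (le_trans (h2 _ s))// ler_wpM2r ?lerDr// sqr_ge0.
Qed.

Lemma nh_invariant_torus_suspension :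
  nh_invariant_torus c [set X | exists t th, X = torus_pt t th].
Proof.
set M := [set X | _].
exists torus; split; first exact: torus_embedding_torus.
  apply/seteqP; split=> [_ [t [th ->]]|_ [u [v <-]]].
    exists (t / T), (th / (2 * pi)).
    by rewrite /torus ![_ * (_ / _)]mulrC !divfK// T_neq0.
  by exists (T * u), (2 * pi * v).
(* The data are indexed by points of space, so parameters are chosen for each point of the torus.
   They are determined up to periods; the value off the torus is arbitrary. *)
have /choice[rep repE] (X : 'rV[R]_3) : exists st : R * R, M X -> X = torus_pt st.1 st.2.
  have [[t [th XE]]|nM] := pselect (M X); first by exists (t, th).
  by exists (0, 0).
pose sol X t := torus_pt ((rep X).1 + t) ((rep X).2 + t).
pose Y X t := transition (rep X).1 (rep X).2 t.
pose N X : 'M[R]_3 := (<<frame3 (rep X).1 (rep X).2>>)%MS.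
have rep_int t th : exists n k : int, (rep (torus_pt t th)).1 = t + n%:~R * T /\
    (rep (torus_pt t th)).2 = th + k%:~R * (2 * pi).
  have [|[n nE] [k kE]] := @torus_pt_inj (rep (torus_pt t th)).1 (rep (torus_pt t th)).2 t th.
    by rewrite -repE//; exists t, th.
  by exists n, k.
have NE t th : N (torus_pt t th) = (<<frame3 t th>>)%MS.
  by have [n [k [e1 e2]]] := rep_int t th; rewrite /N e1 e2 frame3Dint.
have MX t th : M (torus_pt t th) by exists t, th.
have [C3 C30 g3] := frame3_growth.
have [C12 C120 g12] := frame12_growth.
(* The [+ 1] makes the constant strictly positive, as [0 < K] demands. *)
pose C : R := C3 + C12 + 1.
have C0 : 0 <= C by rewrite !addr_ge0.
have C3C : C3 <= C by rewrite /C -addrA lerDl addr_ge0.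
have C12C : C12 <= C by rewrite /C addrAC lerDr addr_ge0.
(* This holds for every real [t]: positive times serve a stable normal line, negative times an
   unstable one. *)
have gN X (t : R) (w : 'rV[R]_3) : (w <= N X)%MS ->
    `|w *m (Y X t)^T| <= Num.sqrt (3 * C) * expR (rate * t) * `|w|.
  rewrite genmxE => /sub_rVP[k ->]; rewrite -scalemxAl /Y.
  have [_ _ ->] := transition_frame (rep X).1 (rep X).2 t.
  apply: norm_of_sqnorm3 => //.
  rewrite !sqnorm_frame3 mulrCA ler_wpM2l ?sqr_ge0// (le_trans (g3 _ _))//.
  by rewrite ler_wpM2r ?addr_ge0 ?sqr_ge0// ler_wpM2r ?sqr_ge0.
have gT u v (t : R) (w : 'rV[R]_3) : (w <= tangent torus u v)%MS ->
    `|w *m (Y (torus u v) t)^T| <= Num.sqrt (3 * C) * `|w|.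
  rewrite tangentE => /sub_addsmxP[[k1 k2] /= ->].
  rewrite [k1]mx11_scalar [k2]mx11_scalar !mul_scalar_mx; set al := k1 _ _; set be := k2 _ _.
  have [n [k [e1 e2]]] := rep_int (T * u) (2 * pi * v).
  have [f1 f2] := frame12Dint n k (T * u) (2 * pi * v).
  rewrite /Y /torus e1 e2 -{1}f1 -{1}f2 mulmxDl -!scalemxAl.
  have [-> -> _] := transition_frame (T * u + n%:~R * T) (2 * pi * v + k%:~R * (2 * pi)) t.
  rewrite -f1 -f2 -[Num.sqrt _]mulr1; apply: norm_of_sqnorm3 => //.
  rewrite expr1n mulr1 !sqnorm_frame12 (le_trans (g12 _ _ _ _))// ler_wpM2r//.
  by rewrite addr_ge0// mulr_ge0 ?addr_ge0 ?sqr_ge0.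
(* The normal line is the whole of one bundle and the other is zero. The tangential rate 0 lies
   strictly below [|rate|], because [|mu|] is not 1. *)
exists sol, Y, (fun X => if rate < 0 then N X else 0), (fun X => if rate < 0 then 0 else N X),
  (Num.sqrt (3 * C)), `|rate|, 0; split.
- move=> X XM; split; first exact: torus_sol.
  + by rewrite /sol !addr0 -repE.
  + by move=> t; exact: MX.
  + exact: transition_fundamental.
- move=> u v; have [full r12 r3] := frame_ranks (T * u) (2 * pi * v).
  have -> : N (torus u v) = (<<frame3 (T * u) (2 * pi * v)>>)%MS := NE _ _.
  rewrite -sub1mx tangentE r12; split.
    rewrite (submx_trans full)// -addsmxE.
    apply: submx_trans (_ : (col_mx (tangent torus u v) (<<frame3 (T * u) (2 * pi * v)>>) <= _)%MS).
      rewrite -addsmxE; apply: addsmxS; first by rewrite tangentE.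
      by rewrite genmxE.
    case: ifP => _; first by rewrite addsmxSl.
    rewrite -!addsmxE; apply: addsmxS => //.
    by apply: submx_trans (addsmxSl _ 0) _; rewrite addsmxE.
  by case: ifP => _; rewrite mxrank0 mxrank_gen r3.
- move=> X t XM.
  suff h : (N X *m (Y X t)^T <= N (sol X t))%MS by case: ifP => _; rewrite ?mul0mx ?sub0mx.
  rewrite /sol NE genmxE /N.
  have [_ _ <-] := transition_frame (rep X).1 (rep X).2 t.
  by apply: submxMr; rewrite genmxE.
- by rewrite sqrtr_gt0 mulr_gt0// ?normr_gt0 ?rate_neq0// /C ltr_wpDl// addr_ge0.
- move=> X t w XM t0; split.
  + case: ifPn => [r0|_ /submx0null->]; last by rewrite mul0mx !normr0 mulr0.
    by move=> /(gN X t); rewrite ltr0_norm// mulNr opprK.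
  + case: ifPn => [_ /submx0null->|]; first by rewrite mul0mx !normr0 mulr0.
    by rewrite -leNgt => r0 /(gN X (- t)); rewrite ger0_norm// mulrN.
  + move=> u v <- wt; rewrite mul0r exp.expR0 mulr1.
    by split; [exact: (gT u v t w wt)|exact: (gT u v (- t) w wt)].
Qed.

End Suspension.

(** * From planar cycles to tori *)

Section Assembly.
Variable R : realType.

Definition row2 (x y : R) : 'rV[R]_2 := \row_(i < 2) nth 0 [:: x; y] i.
Definition i0 : 'I_2 := @Ordinal 2 0 isT.
Definition i1 : 'I_2 := @Ordinal 2 1 isT.

Lemma forall_I2 (P : 'I_2 -> Prop) : P i0 -> P i1 -> forall i, P i.
Proof.
move=> P0 P1 [[|[|//]] i2].
- by rewrite (_ : Ordinal _ = i0)//; exact: val_inj.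
- by rewrite (_ : Ordinal _ = i1)//; exact: val_inj.
Qed.

Lemma sum2 (F : 'I_2 -> R) : \sum_i F i = F i0 + F i1.
Proof.
rewrite !big_ord_recr big_ord0 /= add0r.
by congr (F _ + F _); apply: val_inj.
Qed.

Lemma row2_eta (w : 'rV[R]_2) : w = row2 (w ord0 i0) (w ord0 i1).
Proof. by apply/rowP; apply: forall_I2; rewrite mxE. Qed.

Lemma planar_C1_peval k (c : monom 2 k -> R) (s : R) :
  planar_C1 (fun r z => peval c (row2 (r - s) z))
    (fun r z => pderiv c i0 (row2 (r - s) z)) (fun r z => pderiv c i1 (row2 (r - s) z)).
Proof.
split.
- move=> u v t du dv Du Dv.
  have h i : is_derive t 1 (fun x : R => row2 (u x - s) (v x) ord0 i) (nth 0 [:: du; dv] i).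
    move: i; apply: forall_I2.
    + rewrite (_ : (fun x => _) = (fun x : R => u x - s)); last by apply/funext => x; rewrite mxE.
      by apply: is_derive1_eq (is_derive1B Du (is_derive1_cst t s)) (subr0 _).
    + by rewrite (_ : (fun x => _) = v)//; apply/funext => x; rewrite mxE.
  by apply: is_derive1_eq (peval_chain c h) _; rewrite sum2.
- move=> T u v cu cv.
  have h i : continuous (fun x : T => row2 (u x - s) (v x) ord0 i).
    move: i; apply: forall_I2.
    + rewrite (_ : (fun x => _) = (fun x : T => u x - s)); last by apply/funext => x; rewrite mxE.
      by move=> x; apply: cvgB; [exact: cu|exact: cvg_cst].
    + by rewrite (_ : (fun x => _) = v)//; apply/funext => x; rewrite mxE.
  by split; [exact: peval_continuous|exact: pderiv_continuous|exact: pderiv_continuous].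
- move=> B; have [L [M H]] := loclip_peval c (B + `|s|).
  exists L => u v u' v' hu hv hu' hv'.
  have b (x y : R) : `|x| <= B -> `|y| <= B -> forall i, `|row2 (x - s) y ord0 i| <= B + `|s|.
    move=> hx hy; apply: forall_I2; rewrite mxE /=.
      by rewrite (le_trans (ler_normB _ _))// lerD2r.
    by rewrite (le_trans hy)// lerDl.
  have [_] := H _ _ (b _ _ hu hv) (b _ _ hu' hv').
  by rewrite sum2 !mxE /= (_ : u - s - (u' - s) = u - u')//; ring.
Qed.

Lemma char_poly_tr n (A : 'M[R]_n) : char_poly A^T = char_poly A.
Proof.
rewrite /char_poly -[RHS]det_tr; congr (\det _).
by rewrite /char_poly_mx raddfB /= tr_scalar_mx map_trmx.
Qed.

Lemma is_derive1_mulmx n (Y : R -> 'M[R]_n) (v : 'cV[R]_n) (t : R) i : derivable Y t 1 ->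
  is_derive t 1 (fun s : R => (Y s *m v) i ord0) ((derive1 Y t *m v) i ord0).
Proof.
move=> dY; rewrite (_ : (fun s => _) = (fun s : R => \sum_j v j ord0 * Y s i j)); last first.
  by apply/funext => s; rewrite mxE; apply: eq_bigr => j _; rewrite mulrC.
apply: is_derive1_eq (is_derive1_sum _ _ (fun j => is_derive1Z (v j ord0) (is_derive1_mx i j dY))) _.
by rewrite mxE; apply: eq_bigr => j _; rewrite mulrC.
Qed.

Lemma hyperbolic_cycle_bounded k (c : 'I_2 -> monom 2 k -> R) C : hyperbolic_cycle2 c C ->
  exists B : R, forall y, C y -> `|y ord0 i0| <= B.
Proof.
move=> [x [T [Y [[sx T0 xT _ ->] _]]]].
have [|t|B hB] := @periodic_bounded R (fun t => x t ord0 i0) T T0.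
- by move=> t; apply: is_derive1_continuous (is_derive1_mx ord0 i0 (sx t).1).
- by rewrite xT.
by exists B => _ [t _ <-].
Qed.

Lemma hyperbolic_cycle_lift k (c : 'I_2 -> monom 2 k -> R) C (s : R) :
  hyperbolic_cycle2 c C -> (forall y, C y -> 0 < y ord0 i0 + s) ->
  exists a z b d T mu, lifted_cycle
    (fun r z => peval (c i0) (row2 (r - s) z))
    (fun r z => pderiv (c i0) i0 (row2 (r - s) z)) (fun r z => pderiv (c i0) i1 (row2 (r - s) z))
    (fun r z => peval (c i1) (row2 (r - s) z))
    (fun r z => pderiv (c i1) i0 (row2 (r - s) z)) (fun r z => pderiv (c i1) i1 (row2 (r - s) z))
    a z b d T mu /\ C = [set y | exists t, y = row2 (a t ^+ 2 - s) (z t)].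
Proof.
move=> [x [T [Y [[sx T0 xT xmin CE] [[Y0 dY] [mu [mu1 chi]]]]]]] Cpos.
(* Eigenvectors here are rows acting from the left; the transpose yields the column eigenvector of
   the monodromy matrix that starts the Floquet solution. *)
have : eigenvalue (Y T)^T mu.
  by rewrite eigenvalue_root_char char_poly_tr chi rootM !root_XsubC eqxx orbT.
move=> /eigenvalueP[w we w0].
have {}we : Y T *m w^T = mu *: w^T by rewrite -[Y T]trmxK -trmx_mul we linearZ.
pose r t : R := x t ord0 i0 + s; pose z t : R := x t ord0 i1.
pose e1 t : R := (Y t *m w^T) i0 ord0; pose e2 t : R := (Y t *m w^T) i1 ord0.
have xE t : x t = row2 (r t - s) (z t) by rewrite addrK -row2_eta.
have dx i (t : R) : is_derive t 1 (fun t : R => x t ord0 i) (peval (c i) (x t)).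
  by have [h e] := sx t; apply: is_derive1_eq (is_derive1_mx ord0 i h) _; rewrite e mxE.
have de i (t : R) : is_derive t 1 (fun t : R => (Y t *m w^T) i ord0)
    (pderiv (c i) i0 (x t) * e1 t + pderiv (c i) i1 (x t) * e2 t).
  have [h e] := dY t; apply: is_derive1_eq (is_derive1_mulmx w^T i h) _.
  by rewrite e -mulmxA mxE sum2 [Jac _ _ _ _]mxE [Jac _ _ _ _]mxE.
have [|||||||||||a [z' [b [d [T' [tau [lc [tau' _ tauK] az]]]]]]] :=
    lifted_cycle_exists (planar_C1_peval (c i0) s) (planar_C1_peval (c i1) s)
      (r := r) (z := z) (e1 := e1) (e2 := e2) (T := T) (mu := mu).
- move=> t; rewrite -xE; split; last exact: dx.
  by apply: is_derive1_eq (is_derive1D (dx i0 t) (is_derive1_cst t s)) (addr0 _).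
- exact: T0.
- by move=> t; rewrite /r xT.
- by move=> t; rewrite /z xT.
- move=> u u0 uT ru zu; have /eqP := xmin u u0 uT; apply.
  by rewrite xE ru zu -xE.
- by move=> t; rewrite -xE; split; exact: de.
- by rewrite /e1 we Y0 mul1mx mxE.
- by rewrite /e2 we Y0 mul1mx mxE.
- rewrite /e1 /e2 Y0 mul1mx => -[w1 w2]; move/eqP: w0; apply.
  by apply/rowP; apply: forall_I2; rewrite [RHS]mxE; [rewrite -w1|rewrite -w2]; rewrite mxE.
- exact: mu1.
- by move=> t; apply: Cpos; rewrite CE; exists t.
exists a, z', b, d, T', mu; split => //.
rewrite CE; apply/seteqP; split=> [_ [t _ <-]|_ [t ->]] /=.
  by exists (tau' t); have [-> ->] := az (tau' t); rewrite tauK xE.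
by exists (tau t) => //; have [-> ->] := az t; rewrite xE.
Qed.

Lemma suspension_exists k m (c : 'I_2 -> monom 2 k -> R) (s : R) : (2 * k + 2 <= m)%N ->
  exists c3 : 'I_3 -> monom 3 m -> R, suspension
    (fun r z => peval (c i0) (row2 (r - s) z)) (fun r z => peval (c i1) (row2 (r - s) z)) c3.
Proof.
move=> km; pose g (X : 'rV[R]_3) := row2 (X ord0 o0 ^+ 2 + X ord0 o1 ^+ 2 - s) (X ord0 o2).
have pc (i : 'I_3) : polyfun 1 (fun X : 'rV[R]_3 => X ord0 i) := polyfun_coord R i.
have prho : polyfun 2 (fun X : 'rV[R]_3 => X ord0 o0 ^+ 2 + X ord0 o1 ^+ 2).
  exact: polyfunD (polyfunX 2 (pc o0)) (polyfunX 2 (pc o1)).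
have pg i : polyfun 2 (fun X => g X ord0 i).
  move: i; apply: forall_I2.
  - apply: polyfun_ext (polyfunD prho (polyfun_cst 3 2 (- s))) => X.
    by rewrite /g mxE.
  - by apply: polyfun_ext (@polyfun_leq _ _ 1 2 _ isT (pc o2)) => X; rewrite /g mxE.
have pp i : polyfun (2 * k) (fun X => peval (c i) (g X)) := polyfun_comp (c i) pg.
pose F (i : 'I_3) (X : 'rV[R]_3) := nth 0 [::
  X ord0 o0 * peval (c i0) (g X) / 2 - X ord0 o1;
  X ord0 o1 * peval (c i0) (g X) / 2 + X ord0 o0;
  (X ord0 o0 ^+ 2 + X ord0 o1 ^+ 2) * peval (c i1) (g X)] i.
have pF i : polyfun m (F i).
  have k1 : (1 + 2 * k <= m)%N by lia.
  have k2 : (2 + 2 * k <= m)%N by lia.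
  have m1 : (1 <= m)%N by lia.
  move: i; apply: forall_I3.
  - apply: polyfun_ext (polyfunD (polyfunZ 2^-1 (polyfun_leq k1 (polyfunM (pc o0) (pp i0))))
      (polyfunZ (-1) (polyfun_leq m1 (pc o1)))) => X.
    by rewrite /F /=; ring.
  - apply: polyfun_ext (polyfunD (polyfunZ 2^-1 (polyfun_leq k1 (polyfunM (pc o1) (pp i0))))
      (polyfun_leq m1 (pc o0))) => X.
    by rewrite /F /=; ring.
  - exact: polyfun_ext (polyfun_leq k2 (polyfunM prho (pp i1))).
have /choice[c3 c3E] : forall i, exists cc : monom 3 m -> R, forall X, peval cc X = F i X := pF.
by exists c3 => x y z; split; rewrite c3E /F /g !mxE.
Qed.

(** Describing the torus as the preimage of the cycle under [(x, y, z) |-> (x^2 + y^2 - s, z)]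
    avoids any parametrization, so that the cycle can be recovered from it. *)
Lemma planar_cycle_torus k m (c : 'I_2 -> monom 2 k -> R) (c3 : 'I_3 -> monom 3 m -> R) C (s : R) :
  suspension (fun r z => peval (c i0) (row2 (r - s) z))
    (fun r z => peval (c i1) (row2 (r - s) z)) c3 ->
  hyperbolic_cycle2 c C -> (forall y, C y -> 0 < y ord0 i0 + s) ->
  nh_invariant_torus c3
    [set X | C (row2 (X ord0 o0 ^+ 2 + X ord0 o1 ^+ 2 - s) (X ord0 o2))].
Proof.
move=> cE hC Cpos; have [a [z [b [d [T [mu [lc CE]]]]]]] := hyperbolic_cycle_lift hC Cpos.
have := nh_invariant_torus_suspension (planar_C1_peval (c i0) s) (planar_C1_peval (c i1) s) cE lc.
congr nh_invariant_torus; apply/seteqP; split=> [_ [t [th ->]]|X] /=.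
  by rewrite CE /torus_pt !mxE /= polar_sqr; exists t.
rewrite CE => -[t /rowP tE].
have := tE i0; have := tE i1; rewrite !mxE /= => zE /addIr aE.
have at0 : 0 < a t by have [[_ _ _ /(_ t)[[]]]] := lc.
have [|th [cE' sE]] := @polar_angle R (X ord0 o0 / a t) (X ord0 o1 / a t).
  by rewrite !expr_div_n -mulrDl aE divff// expf_neq0// gt_eqF.
exists t, th; rewrite [LHS]row3_eta /torus_pt zE -cE' -sE.
by rewrite ![a t * _]mulrC !divfK// gt_eqF.
Qed.

Lemma planar_cycles_to_tori (m L : nat) : (2 <= m)%N ->
  (exists (cPQ : 'I_2 -> monom 2 (m./2 - 1) -> R) (C : 'I_L -> set 'rV[R]_2),
      injective C /\ forall i, hyperbolic_limit_cycle2 cPQ (C i)) ->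
  exists (cPQR : 'I_3 -> monom 3 m -> R) (T : 'I_L -> set 'rV[R]_3),
      injective T /\ forall i, nh_invariant_torus cPQR (T i).
Proof.
move=> m2 [c [C [Cinj Chyp]]].
have hyp i : hyperbolic_cycle2 c (C i) := (Chyp i).2.
have /choice[B BE] i := hyperbolic_cycle_bounded (hyp i).
(* One shift must serve all cycles, since a single field carries all the tori; the [+ 1] makes
   positivity strict. *)
pose s : R := \sum_i `|B i| + 1.
have Cpos i y : C i y -> 0 < y ord0 i0 + s.
  move=> /BE; rewrite ler_norml => /andP[yB _].
  have : B i <= \sum_i `|B i|.
    by rewrite (le_trans (ler_norm _))// (bigD1 i)//= lerDl sumr_ge0.
  by rewrite /s; lra.
(* As [m >= 2], the subtraction in [m./2 - 1] is not truncated, and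
   [2 * (m./2 - 1) + 2 = 2 * m./2 <= m]. *)
have [|c3 c3E] := @suspension_exists _ m c s.
  by have := odd_double_half m; rewrite -muln2; lia.
exists c3, (fun i => [set X | C i (row2 (X ord0 o0 ^+ 2 + X ord0 o1 ^+ 2 - s) (X ord0 o2))]).
split; last by move=> i; apply: planar_cycle_torus => //; exact: Cpos.
(* Lifting a planar point at angle 0 turns membership in the cycle into membership in its torus, so
   equal tori come from equal cycles. *)
have lift i (y : 'rV[R]_2) : 0 < y ord0 i0 + s -> [set X : 'rV[R]_3 |
    C i (row2 (X ord0 o0 ^+ 2 + X ord0 o1 ^+ 2 - s) (X ord0 o2))]
    (row3 (Num.sqrt (y ord0 i0 + s)) 0 (y ord0 i1)) = C i y.
  move=> y0; rewrite /= !mxE /= sqr_sqrtr; last exact: ltW.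
  by rewrite expr0n addr0 addrK -row2_eta.
move=> i j ij; apply: Cinj; apply/seteqP; split=> y Cy; have y0 := Cpos _ _ Cy.
  by rewrite -(lift j y y0) -ij lift.
by rewrite -(lift i y y0) ij lift.
Qed.

End Assembly.

Notation RR := Rdefinitions.R.

Theorem theoremB (m L : nat) :
  (2 <= m)%N ->
  (exists (cPQ : 'I_2 -> monom 2 (m./2 - 1) -> RR) (C : 'I_L -> set 'rV[RR]_2),
      injective C /\ forall i, @hyperbolic_limit_cycle2 RR _ cPQ (C i)) ->
  exists (cPQR : 'I_3 -> monom 3 m -> RR) (T : 'I_L -> set 'rV[RR]_3),
      injective T /\ forall i, @nh_invariant_torus RR _ cPQR (T i).
Proof. exact: planar_cycles_to_tori. Qed.
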